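(* If $\mathcal{C}$ is a permutation class that is a proper subclass of $\mathcal{C}_{2,0}$, then $\mathcal{C}$-Pattern PPM can be solved in polynomial time.
   Context: A permutation of size $n$ is a bijection of $[n]$ to itself, written as a sequence $\pi(1),\dots,\pi(n)$. A permutation $\tau$ of size $n$ contains a permutation $\pi$ of size $k$ if there are indices $i_1<\dots<i_k$ with $\tau(i_a)<\tau(i_b)$ iff $\pi(a)<\pi(b)$ for all $a,b\in[k]$. A permutation class is a set $\mathcal{C}$ of permutations such that every permutation contained in a member of $\mathcal{C}$ also belongs to $\mathcal{C}$. $\mathcal{C}_{2,0}$ is the class of permutations that can be partitioned into two increasing subsequences (equivalently, permutations avoiding $321$). A proper subclass of $\mathcal{C}_{2,0}$ is a permutation class contained in and different from $\mathcal{C}_{2,0}$. The problem $\mathcal{C}$-Pattern PPM has as input a pattern $\pi\in\mathcal{C}$ of size $k$ and an arbitrary permutation $\tau$ of size $n\ge k$, and asks whether $\tau$ contains $\pi$. *)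

(* Defs.v *)
From mathcomp Require Import all_boot all_order all_algebra all_fingroup.

Set Implicit Arguments.
Unset Strict Implicit.
Unset Printing Implicit Defensive.

(** A permutation of size [n] is an element of ['S_n]; positions and values
    are 0-based. *)

Definition contains n (tau : 'S_n) k (pi : 'S_k) : Prop :=
  exists f : 'I_k -> 'I_n,
    {homo f : a b / a < b} /\
    (forall a b, (tau (f a) < tau (f b)) = (pi a < pi b)).

Definition perm_set := forall n, 'S_n -> Prop.

Definition permutation_class (C : perm_set) : Prop :=
  forall n (tau : 'S_n) k (pi : 'S_k), C n tau -> contains tau pi -> C k pi.

Definition increasing_on n (s : 'S_n) (A : {set 'I_n}) : Prop :=
  {in A &, {homo s : i j / i < j}}.

Definition C20 : perm_set :=
  fun n s => exists A : {set 'I_n}, increasing_on s A /\ increasing_on s (~: A).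

Definition proper_subclass (C D : perm_set) : Prop :=
  [/\ permutation_class C,
      (forall n (s : 'S_n), C n s -> D n s) &
      ~ (forall n (s : 'S_n), C n s <-> D n s)].

(** A random access machine: memory consists of registers indexed by [nat] and
    holding natural numbers. Programs are structured, with indirect addressing; the only
    arithmetic is addition and truncated subtraction. Every expression node,
    assignment and test costs one step. Since there is no multiplication, [t]
    steps produce numbers of at most [t] bits more than the longest number in
    the input or in the program text, so this unit-cost time is polynomially
    equivalent to Turing machine time. *)

Definition memory := nat -> nat.

Definition update (m : memory) (a v : nat) : memory :=
  fun x => if x == a then v else m x.

Inductive expr : Type :=
| Const of nat
| Read of expr
| Add of expr & expr
| Sub of expr & expr.

Fixpoint eval (m : memory) (e : expr) : nat :=
  match e with
  | Const c => c
  | Read e1 => m (eval m e1)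
  | Add e1 e2 => eval m e1 + eval m e2
  | Sub e1 e2 => eval m e1 - eval m e2
  end.

Fixpoint expr_cost (e : expr) : nat :=
  match e with
  | Const _ => 1
  | Read e1 => (expr_cost e1).+1
  | Add e1 e2 | Sub e1 e2 => (expr_cost e1 + expr_cost e2).+1
  end.

Inductive program : Type :=
| Skip
| Write of expr & expr
| Seq of program & program
| If of expr & program & program
| While of expr & program.

(** [exec P m t m']: started on memory [m], the program [P] halts after exactly
    [t] steps with memory [m']. A test succeeds when its value is nonzero. *)
Inductive exec : program -> memory -> nat -> memory -> Prop :=
| ExecSkip m : exec Skip m 1 m
| ExecWrite a e m :
    exec (Write a e) m (expr_cost a + expr_cost e).+1
         (update m (eval m a) (eval m e))
| ExecSeq P Q m m1 m2 t1 t2 :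
    exec P m t1 m1 -> exec Q m1 t2 m2 -> exec (Seq P Q) m (t1 + t2) m2
| ExecIfT e P Q m m1 t :
    eval m e != 0 -> exec P m t m1 -> exec (If e P Q) m (expr_cost e + t).+1 m1
| ExecIfF e P Q m m1 t :
    eval m e = 0 -> exec Q m t m1 -> exec (If e P Q) m (expr_cost e + t).+1 m1
| ExecWhileT e P m m1 m2 t1 t2 :
    eval m e != 0 -> exec P m t1 m1 -> exec (While e P) m1 t2 m2 ->
    exec (While e P) m (expr_cost e + t1 + t2).+1 m2
| ExecWhileF e P m :
    eval m e = 0 -> exec (While e P) m (expr_cost e).+1 m.

Lemma exec_deterministic P m t1 m1 t2 m2 :
  exec P m t1 m1 -> exec P m t2 m2 -> t1 = t2 /\ m1 = m2.
Proof.
have uniqIH Q n t n' t' n'' :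
    (forall t2 m2, exec Q n t2 m2 -> t = t2 /\ n' = m2) ->
    exec Q n t' n'' -> t' = t /\ n'' = n'.
  by move=> IH /IH[-> ->].
move=> ex1; elim: ex1 t2 m2 => {P m t1 m1}
  [m|a e m|P Q m m1 m2 t1 t2 _ IH1 _ IH2|e P Q m m1 t ne _ IH1
  |e P Q m m1 t e0 _ IH1|e P m m1 m2 t1 t2 ne _ IH1 _ IH2|e P m e0] t' m' ex2;
  inversion ex2; subst => //;
  try match goal with
    H0 : eval ?m ?e = 0, H1 : is_true (eval ?m ?e != 0) |- _ =>
      by rewrite H0 in H1
  end;
  repeat match goal with
    IH : forall t m, exec ?P ?m0 t m -> _, H : exec ?P ?m0 _ _ |- _ =>
      have [? ?] := uniqIH _ _ _ _ _ _ IH H; clear H; subst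
  end => //.
Qed.

Definition one_line n (s : 'S_n) : seq nat := [seq val (s i) | i <- enum 'I_n].

Definition encode k (pi : 'S_k) n (tau : 'S_n) : seq nat :=
  [:: k, n & one_line pi ++ one_line tau].

Definition load (s : seq nat) : memory := nth 0 s.

(** Input length is counted in registers; as all the numbers in
    [encode pi tau] are at most that length, this is polynomially equivalent to
    counting bits. The condition [C k pi] is a promise on the input: the program
    may depend on [C], but need not recognise the members of [C]. The answer is
    read off register 0, nonzero meaning yes. *)
Definition pattern_PPM_in_P (C : perm_set) : Prop :=
  exists (P : program) (p : {poly nat}),
    forall k (pi : 'S_k) n (tau : 'S_n), C k pi -> k <= n ->
    exists (t : nat) (m : memory),
      [/\ exec P (load (encode pi tau)) t m,
          t <= p.[size (encode pi tau)]%R &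
          m 0 != 0 <-> contains tau pi].

(* Main.v *)
(* A 321-avoiding permutation can be drawn on a staircase of increasing cells
   ("columns"), where a single height function records how consecutive columns
   interleave.  Push a wave front upwards through a window of consecutive columns:
   if it survives long enough, its positions form a wall containing any
   prescribed 321-avoider sigma; if it gets stuck, backtracking from the stuck
   point yields a short curve that separates the left of the window from its
   right.  Hence, if sigma is avoided, every window has a bounded separator, and
   sweeping upwards between consecutive separators gives a path decomposition
   of bounded width of the graph of consecutive positions and consecutive
   values.  With K at least that width, the pattern embeds in the text if and
   only if some placement of K pebbles survives the K-pebble consistency game, and
   the surviving placements are computed by a polynomial fixpoint iteration. *)
Require Import Defs.
From mathcomp Require Import all_boot all_order all_algebra all_fingroup.
From mathcomp Require Import zify.
From Stdlib Require Import ClassicalEpsilon FunctionalExtensionality.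

Set Implicit Arguments.
Unset Strict Implicit.
Unset Printing Implicit Defensive.

(** * Staircase drawings *)

(** The path decomposition is never computed: it occurs only in the correctness proof, and the
    program depends on the class only through the number [K]. This number comes from a single
    321-avoider sigma outside the class, chosen classically. If sigma has size m, a wave that rises
    m times yields a wall large enough for sigma, while one that stops earlier leaves at most m
    separator points. Windows have M = 2(m + 4) columns, and a bag meets two windows with at most m
    + 4M points in each.

    One height function for all columns exists because the comparisons forced between neighbouring
    columns are acyclic.

    The obstacle for the decomposition is that consecutive positions or values may lie in different
    strips, where the curves give no control. Such a pair consists of the top of one column and the
    bottom of a nearby one; so tops and bottoms stay in the bags for two whole regions, at a
    constant cost per column. *)

Lemma linear_extension (T : finType) (R : rel T) :
  (forall A : {set T}, A != set0 ->
     exists2 x, x \in A & forall y, y \in A -> ~~ R y x) ->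
  exists h : T -> nat,
    [/\ injective h, forall x, h x < #|T| & forall x y, R x y -> h x < h y].
Proof.
move=> wfR.
suff ext n (A : {set T}) : #|A| = n -> exists h : T -> nat,
    [/\ {in A &, injective h}, {in A, forall x, h x < n}
      & {in A &, forall x y, R x y -> h x < h y}].
  have [h [h1 h2 h3]] := ext _ [set: T] (erefl _).
  exists h; split=> [x y|x|x y]; first exact: h1.
    by have := h2 x; rewrite cardsT; apply.
  by apply: h3.
elim: n A => [|n IHn] A cardA.
  exists (fun=> 0); move/eqP: cardA; rewrite cards_eq0 => /eqP ->.
  by split=> x; rewrite inE.
have [|x Ax minx] := wfR A; first by rewrite -cards_eq0 cardA.
have [|h [h1 h2 h3]] := IHn (A :\ x).
  by apply/eqP; rewrite -eqSS -cardA (cardsD1 x A) Ax.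
have inD y : y \in A -> y != x -> y \in A :\ x by rewrite !inE => -> ->.
exists (fun y => if y == x then 0 else (h y).+1); split.
- move=> y z Ay Az; case: (eqVneq y x) => [->|nyx]; case: (eqVneq z x) => [->|nzx] //.
  by case=> /h1; apply; apply: inD.
- by move=> y Ay; case: (eqVneq y x) => // nyx; rewrite ltnS h2 ?inD.
- move=> y z Ay Az; case: (eqVneq z x) => [->|nzx Ryz].
    by move=> Ryx; have := minx _ Ay; rewrite Ryx.
  by case: (eqVneq y x) => // nyx; rewrite ltnS h3 ?inD.
Qed.

Section Staircase.

Variables (n : nat) (s : 'S_n).
Hypothesis s_C20 : C20 s.

Definition southwest (x y : 'I_n) := (x < y) && (s x < s y).

Definition lr_max (x : 'I_n) := [forall y : 'I_n, (y < x) ==> (s y < s x)].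

Lemma lr_maxP (x y : 'I_n) : lr_max x -> y < x -> s y < s x.
Proof. by move/forallP/(_ y)/implyP; apply. Qed.

Lemma s_neq (x y : 'I_n) : x < y -> s x <> s y :> nat.
Proof. by move=> lt_xy /val_inj/perm_inj eq_xy; rewrite eq_xy ltnn in lt_xy. Qed.

(** An earlier and higher point than [x] would complete a decreasing triple, two points of which
    share a part of the partition. *)
Lemma inversion_lr_max (x y : 'I_n) : x < y -> s y < s x -> lr_max x /\ ~~ lr_max y.
Proof.
move=> lt_xy lt_s; split; last first.
  by apply/negP=> /lr_maxP/(_ lt_xy); lia.
apply/forallP=> z; apply/implyP=> lt_zx; rewrite ltnNge; apply/negP=> le_s.
have {le_s} lt_sz : s x < s z.
  by rewrite ltn_neqAle le_s andbT; apply/eqP => /esym/s_neq.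
have [A [incA incC]] := s_C20.
have absA (B : {set 'I_n}) u v : increasing_on s B ->
    u \in B -> v \in B -> u < v -> s v < s u -> False.
  by move=> incB Bu Bv /(incB _ _ Bu Bv); lia.
have [Ax|Ax] := boolP (x \in A); have [Ay|Ay] := boolP (y \in A);
have [Az|Az] := boolP (z \in A);
by [apply: (absA _ x y incA) | apply: (absA _ z x incA) | apply: (absA _ z y incA); lia
  | apply: (absA _ x y incC); rewrite ?inE | apply: (absA _ z x incC); rewrite ?inE
  | apply: (absA _ z y incC); rewrite ?inE //; lia].
Qed.

Lemma lr_max_eq_lt (x y : 'I_n) : lr_max x = lr_max y -> x < y -> s x < s y.
Proof.
move=> eq_t lt_xy; rewrite ltnNge; apply/negP=> le_s.
have [] := @inversion_lr_max x y lt_xy; last by rewrite eq_t => ->.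
by rewrite ltn_neqAle le_s andbT; apply/eqP => /esym/s_neq; apply.
Qed.

(** The column counts type changes along a best southwest chain ending at [x]; starting from
    [lr_max] makes its parity equal to the type. The recursion moves to smaller positions, so fuel
    [n] suffices. *)
Fixpoint column_rec f (x : 'I_n) : nat :=
  if f is f'.+1 then
    maxn (lr_max x)
         (\max_(y | southwest y x && (lr_max y != lr_max x)) (column_rec f' y).+1)
  else lr_max x.

Definition column := column_rec n.

Lemma columnE x :
  column x = maxn (lr_max x)
    (\max_(y | southwest y x && (lr_max y != lr_max x)) (column y).+1).
Proof.
suff stable f (y : 'I_n) : y <= f -> column_rec f y = column_rec f.+1 y.
  by rewrite [LHS]/column stable // ltnW.
elim: f y => [|f IHf] y le_y.
  rewrite /= big_pred0 ?maxn0 // => z; rewrite /southwest; lia.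
rewrite [LHS]/= [RHS]/=; congr maxn; apply: eq_bigr => z /andP[/andP[lt_zy _] _].
by rewrite IHf //; lia.
Qed.

Lemma column_cases x :
  column x = lr_max x \/
  exists y, [/\ southwest y x, lr_max y != lr_max x & column x = (column y).+1].
Proof.
rewrite columnE; pose P y := southwest y x && (lr_max y != lr_max x).
have [y0 Py0|noP] := pickP P; last by left; rewrite big_pred0 ?maxn0.
have [|y Py ->] := eq_bigmax_cond (fun y => (column y).+1) (A := [pred y | P y]).
  by apply/card_gt0P; exists y0.
have [le|lt] := leqP (column y).+1 (lr_max x); [left|right] => //.
by exists y; case/andP: Py => sw neq; split.
Qed.

Lemma column_southwest x y :
  southwest x y -> lr_max x != lr_max y -> column x < column y.
Proof.
move=> sw neq; rewrite (columnE y) leq_max; apply/orP; right.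
by apply: (@leq_bigmax_cond _ (fun x => southwest x y && (lr_max x != lr_max y))
  (fun y => (column y).+1)); rewrite sw neq.
Qed.

Lemma column_ge x : lr_max x <= column x.
Proof. by rewrite columnE leq_maxl. Qed.

Lemma odd_column x : odd (column x) = lr_max x.
Proof.
have [m] := ubnP (nat_of_ord x); elim: m x => // m IHm x ltx.
have [->|[y [/andP[lt_yx _] neq ->]]] := column_cases x; first by case: lr_max.
by rewrite /= IHm; [case: (lr_max x) (lr_max y) neq => [] [] | lia].
Qed.

Lemma column_le x : column x <= n.
Proof.
suff: column x <= x.+1 by move/leq_trans; apply.
have [m] := ubnP (nat_of_ord x); elim: m x => // m IHm x ltx.
have [->|[y [/andP[lt_yx _] neq ->]]] := column_cases x; first by case: lr_max.
have := IHm y; lia.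
Qed.

Lemma column_pred x : 1 < column x -> exists y, (column y).+1 = column x.
Proof.
by have [->|[y [_ _ ->]]] := column_cases x; [case: lr_max | exists y].
Qed.

Lemma column_mono (x y : 'I_n) : lr_max x = lr_max y -> x < y -> column x <= column y.
Proof.
move=> eq_t lt_xy; have lt_s := lr_max_eq_lt eq_t lt_xy.
have [->|[z [/andP[lt_zx lt_sz] neq ->]]] := column_cases x.
  by rewrite eq_t column_ge.
apply: column_southwest; last by rewrite -eq_t.
by rewrite /southwest !(ltn_trans _ lt_xy, ltn_trans _ lt_s).
Qed.

Lemma column_inversion (x y : 'I_n) :
  x < y -> s y < s x -> column x <= (column y).+1 /\ column y <= (column x).+1.
Proof.
move=> lt_xy lt_s; have [tx ty] := inversion_lr_max lt_xy lt_s; split.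
  have [->|[z [/andP[lt_zx lt_sz] neq ->]]] := column_cases x; first by rewrite tx.
  rewrite ltnS; apply: column_mono; last exact: ltn_trans lt_zx lt_xy.
  by move: neq; rewrite tx (negPf ty); case: lr_max.
have [->|[z [/andP[lt_zx lt_sz] neq ->]]] := column_cases y; first by rewrite (negPf ty).
have tz : lr_max z = lr_max x by move: neq; rewrite tx (negPf ty); case: lr_max.
have [lt_xz|lt_zx'|/val_inj -> //] := ltngtP x z.
  by have := lr_max_eq_lt (esym tz) lt_xz; lia.
by rewrite ltnS column_mono.
Qed.

(** Inversions join columns at distance at most one, and within one type columns grow with position.
    Hence heights matter only for equal or neighbouring columns. *)
Lemma column_far (x y : 'I_n) : (column x).+2 <= column y -> southwest x y.
Proof.
move=> far; have neq_xy : x <> y by move=> eq_xy; rewrite eq_xy in far; lia.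
have neq_s : s x <> s y by move/perm_inj.
have {}neq_xy : x <> y :> nat by move/val_inj.
have {}neq_s : s x <> s y :> nat by move/val_inj.
have [t|t] := eqVneq (lr_max x) (lr_max y).
  have [lt_xy|lt_yx|//] := ltngtP x y; first by rewrite /southwest lt_xy lr_max_eq_lt.
  by have := column_mono (esym t) lt_yx; lia.
rewrite /southwest.
have [lt_xy|lt_yx|//] := ltngtP x y; have [lt_s|lt_s|//] := ltngtP (s x) (s y) => //.
- by have [] := column_inversion lt_xy lt_s; lia.
- by have [] := column_inversion lt_yx lt_s; lia.
have := @column_southwest y x; rewrite /southwest lt_yx lt_s eq_sym => /(_ isT t); lia.
Qed.

(** The height comparisons that the drawing forces. For two points of neighbouring columns exactly
    one direction holds. *)
Definition below (x y : 'I_n) :=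
  [|| (column x == column y) && (x < y),
      (column y == (column x).+1) && southwest x y
    | (column x == (column y).+1) && ~~ southwest y x].

(** Climb through the columns. The current point has nothing of [A] below it in its own or lower
    columns; if some point of the next column is below it, pass to the leftmost point of [A] there.
    At most [n] columns can be climbed. *)
Lemma below_wf (A : {set 'I_n}) : A != set0 ->
  exists2 x, x \in A & forall y, y \in A -> ~~ below y x.
Proof.
case/set0Pn=> x0 Ax0.
pose first x := forall y, y \in A -> column y <= column x -> ~~ below y x.
suff climb m x : x \in A -> first x -> n < m + column x ->
    exists2 x, x \in A & forall y, y \in A -> ~~ below y x.
  have [x1 Ax1 min1] := arg_minnP column Ax0.
  have Px1 : (x1 \in A) && (column x1 == column x1) by apply/andP; split.
  have [x /andP[Ax cx] minx] :=
    @arg_minnP _ x1 [pred x | (x \in A) && (column x == column x1)] (@nat_of_ord n) Px1.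
  apply: (climb n.+1 x) => //; last lia.
  move=> y Ay le_y; have cy : column y = column x1 by have := min1 y Ay; lia.
  have := minx y; rewrite /= Ay cy eqxx => /(_ isT).
  by rewrite /below; have := eqP cx; lia.
elim: m x => [|m IHm] x Ax fx lt_n; first by have := column_le x; lia.
have [z /and3P[Az cz bz]|noz] :=
  pickP [pred z | [&& z \in A, column z == (column x).+1 & below z x]]; last first.
  exists x => // y Ay; apply/negP=> byx.
  have [le_y|gt_y] := leqP (column y) (column x); first by have := fx y Ay le_y; rewrite byx.
  by have := noz y; rewrite /= Ay byx; move: byx; rewrite /below; lia.
have Pz : (z \in A) && (column z == (column x).+1) by rewrite Az cz.
have [y /andP[Ay cy] miny] :=
  @arg_minnP _ z [pred z | (z \in A) && (column z == (column x).+1)] (@nat_of_ord n) Pz.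
(* [y] is weakly southwest of [z], so [southwest x y] would give [southwest x z], against
   [below z x]. *)
have nsw : ~~ southwest x y.
  apply/negP=> /andP[lt_xy lt_s].
  have le_yz : y <= z by apply: miny.
  have szy : s y <= s z.
    have [lt_yz|gt_yz|/val_inj <- //] := ltngtP y z; last by lia.
    have ez : lr_max y = lr_max z by rewrite -!odd_column (eqP cz) (eqP cy).
    by apply/ltnW/lr_max_eq_lt.
  move: bz; rewrite /below (eqP cz) /southwest; lia.
apply: (IHm y) => //; last by rewrite (eqP cy); lia.
move=> w Aw cw; apply/negP; rewrite /below => /or3P[/andP[/eqP e lt_wy]|/andP[/eqP e sw]|].
- by have := miny w; rewrite /= Aw e cy; lia.
- have ew : column w = column x by lia.
  have := fx w Aw; rewrite ew leqnn => /(_ isT); rewrite /below ew eqxx /=.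
  have tw : lr_max x = lr_max w by rewrite -!odd_column ew.
  have [lt_wx|lt_xw|/val_inj eq_xw] := ltngtP w x => // _; last by rewrite -eq_xw sw in nsw.
  have := lr_max_eq_lt tw lt_xw.
  by move: nsw sw; rewrite /southwest; lia.
- by lia.
Qed.

End Staircase.

Definition lex (b : nat -> nat) (T : Type) (c h : T -> nat) (x y : T) : bool :=
  (b (c x) < b (c y)) || (b (c x) == b (c y)) && (h x < h y).

Lemma lex_total b (T : eqType) (c h : T -> nat) x y :
  injective h -> x != y -> ~~ lex b c h x y -> lex b c h y x.
Proof.
move=> inj_h neq; have {neq} : h x <> h y by move/inj_h=> e; rewrite e eqxx in neq.
rewrite /lex; lia.
Qed.

(* Drawing of a 321-avoiding permutation on an infinite staircase of increasing
   cells: [c x] is the cell of [x] along the staircase, cells [2i, 2i+1] share a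
   vertical strip and cells [2i-1, 2i] a horizontal one; one height function
   [h] records how neighbouring cells interleave. *)
Definition staircase n (s : 'S_n) (c h : 'I_n -> nat) : Prop :=
  [/\ injective h /\ (forall x, h x < n),
      (forall x, c x <= n) /\
        (forall x, 1 < c x -> exists y, (c y).+1 = c x),
      (forall x y : 'I_n, (x < y) = lex half c h x y) &
      (forall x y, (s x < s y) = lex uphalf c h x y)].

Lemma staircase_exists n (s : 'S_n) : C20 s -> exists c h, staircase s c h.
Proof.
move=> s321; have [h [inj_h h_lt h_mono]] := linear_extension (below_wf s321).
have hb x y : h x < h y -> ~~ below s y x.
  by move=> lt_h; apply/negP=> /h_mono; lia.
have inv := inversion_lr_max s321; have far := @column_far _ s s321.
have sw := @column_southwest _ s; have odd_c := odd_column s.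
have neq_s (x y : 'I_n) : x <> y :> nat -> s x <> s y :> nat.
  by move=> neq /val_inj/perm_inj e; rewrite e in neq.
(* As [lex] is total on distinct points, one implication gives the equivalence. *)
have totalE (b : nat -> nat) (f : 'I_n -> nat) :
    (forall x y, lex b (column s) h x y -> f x < f y) ->
    forall x y, (f x < f y) = lex b (column s) h x y.
  move=> W x y; apply/idP/idP=> [lt|/W //]; apply/negPn/negP=> nlex.
  have [e|neq] := eqVneq x y; first by rewrite e ltnn in lt.
  by have := W _ _ (lex_total inj_h neq nlex); lia.
exists (column s), h; split.
- by split=> // x; have := h_lt x; rewrite card_ord.
- split; [exact: column_le | exact: column_pred].
- apply: totalE => x y.
  have [e|/eqP ne] := eqVneq x y; first by rewrite e /lex; lia.
  have {}ne : x <> y :> nat by move/val_inj.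
  rewrite /lex ltnNge => L; apply/negP => le_yx.
  have {le_yx} lt_yx : y < x by lia.
  have nes := neq_s _ _ ne; have := odd_c x; have := odd_c y.
  have := far x y; have := inv _ _ lt_yx; have := sw y x; have := hb x y.
  by rewrite /below /southwest; case: (lr_max s x); case: (lr_max s y); lia.
- apply: (totalE _ (fun x => s x)) => x y.
  have [e|/eqP ne] := eqVneq x y; first by rewrite e /lex; lia.
  have {}ne : x <> y :> nat by move/val_inj.
  rewrite /lex ltnNge => L; apply/negP => le_yx.
  have nes := neq_s _ _ ne; have := odd_c x; have := odd_c y.
  have := far x y; have := inv x y; have := sw y x; have := hb x y.
  by rewrite /below /southwest; case: (lr_max s x); case: (lr_max s y); lia.
Qed.

(** * Separators *)

Section Separators.

Variables (T : finType) (c h : T -> nat).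
Hypothesis inj_h : injective h.

(** Two points that are consecutive inside one vertical or horizontal strip form such a pair. *)
Definition ladder_adjacent (x y : T) : Prop :=
  [/\ h x < h y, c x <= (c y).+1, c y <= (c x).+1 &
      forall z, (c z == c x) || (c z == c y) -> ~~ (h x < h z < h y)].

Definition separates (a b : nat) (S : seq T) (right : T -> bool) : Prop :=
  [/\ forall x, c x = a -> ~~ right x,
      forall x, c x = b -> right x &
      forall x y, x \notin S -> y \notin S -> ladder_adjacent x y ->
        right x = right y].

(* A curve climbing between the columns: at height [t] it runs in the gap
   between the columns [theta t - 1] and [theta t], and it crosses a column only
   at the points of [S]. Between two crossings one of the two columns
   adjacent to the gap is empty. *)
Definition curve (S : seq T) (theta : nat -> nat) (t0 : nat) : Prop :=
  [/\ forall t, t.+1 < t0 -> (forall q, q \in S -> h q != t.+1) ->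
        theta t.+1 = theta t,
      forall q, q \in S -> h q < t0 -> c q <= theta (h q) <= (c q).+1,
      forall q t, q \in S -> h q = t.+1 -> t < t0 -> c q <= theta t <= (c q).+1 &
      forall x y, x \notin S -> y \notin S -> h x < h y -> h y < t0 ->
        c x <= (c y).+1 -> c y <= (c x).+1 -> c x != c y ->
        (forall t, h x <= t <= h y -> theta t = maxn (c x) (c y)) ->
        exists2 q, q \in S & h x < h q < h y].

(** The side of a point [z] is the truth value of [theta (h z) <= c z]. To change sides between two
    ladder-adjacent points, the curve would have to cross one of their columns, at a point of [S]
    strictly between them. *)
Lemma curve_separates S theta t0 x y :
  curve S theta t0 -> (forall z, h z < t0) -> x \notin S -> y \notin S ->
  ladder_adjacent x y -> (theta (h x) <= c x) = (theta (h y) <= c y).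
Proof.
move=> [jump cross1 cross2 void] lt_t0 Sx Sy [lt_h cxy cyx noz].
have const d t : (d == c x) || (d == c y) -> h x <= t <= h y ->
    (theta t <= d) = (theta (h x) <= d).
  move=> d_xy; elim: t => [|t IHt] /andP[le_xt le_ty].
    by have -> : h x = 0 by lia.
  have [->//|neq] := eqVneq (h x) t.+1.
  rewrite -IHt; last by lia.
  have [q Sq|noq] := pickP [pred q | (q \in S) && (h q == t.+1)]; last first.
    rewrite jump //; first by have := lt_t0 y; lia.
    by move=> q Sq; have := noq q; rewrite /= Sq /= => ->.
  case/andP: Sq => Sq /eqP hq.
  have := cross1 q Sq (lt_t0 q); rewrite hq => {}cross1.
  have := cross2 q t Sq hq; rewrite (_ : t < t0); last by have := lt_t0 y; lia.
  move=> /(_ isT) {}cross2.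
  have [cq|ncq] := eqVneq (c q) d; last by lia.
  have := noz q; rewrite cq => /(_ d_xy).
  have nqy : h q <> h y by move=> /inj_h e; rewrite -e Sq in Sy.
  by lia.
have [e|ne] := eqVneq (c x) (c y).
  by rewrite -[in RHS]e const ?eqxx //; lia.
have y1 : (theta (h y) <= c y) = (theta (h x) <= c y) by apply: const; rewrite ?eqxx ?orbT //; lia.
(* On opposite sides, the curve stays in the gap between the two columns all the way. The void
   condition then provides a point of [S] next to this gap, hence in one of the two columns, against
   adjacency. *)
rewrite y1; case: (eqVneq (theta (h x) <= c x) (theta (h x) <= c y)) => // neq; exfalso.
have [|q Sq hq] := void x y Sx Sy lt_h (lt_t0 y) cxy cyx ne.
  move=> t ht; have := const (c x) t; have := const (c y) t; rewrite !eqxx orbT ht.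
  by move=> /(_ isT isT) + /(_ isT isT); lia.
have := noz q; have := cross1 q Sq (lt_t0 q).
have := const (c x) (h q); have := const (c y) (h q); rewrite !eqxx orbT.
by lia.
Qed.

(** Below its first point the column of [p] is empty, so the curve may rise beside it without any
    crossing. *)
Lemma curve_start a b p : c p = a -> a < b \/ b < a -> 
  (forall z, c z = c p -> h p <= h z) -> a <= b.+1 -> b <= a.+1 ->
  curve [:: p] (fun=> maxn a b) (h p).
Proof.
move=> cp nab first ab ba; split=> //.
- by move=> q; rewrite inE => /eqP ->; lia.
- by move=> q t; rewrite inE => /eqP ->; lia.
- move=> x y Sx Sy lt_xy lt_yp cxy cyx ne /(_ (h x)) e.
  by have := first x; have := first y; lia.
Qed.

(** The gap may change at the height of [p], since both the old and the new gap touch its column.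
    Above [p] the curve runs beside column [e], which is empty up to [t1]. *)
Lemma curve_step S theta p r t1 e :
  curve S theta (h p) -> p \in S -> (forall q, q \in S -> h q <= h p) ->
  h p < t1 -> c p <= r <= (c p).+1 -> e <= r <= e.+1 ->
  (forall z, c z = e -> ~~ (h p < h z < t1)) ->
  curve S (fun t => if t < h p then theta t else r) t1.
Proof.
move=> [jump cross1 cross2 void] Sp Sle lt_t1 rp re empty_e; split.
- move=> t lt_t noq.
  have [lt_tp|le_pt] := ltnP t.+1 (h p).
    by rewrite ltnW // jump.
  have [lt_tp|//] := ltnP t (h p).
  by have := noq p Sp; lia.
- move=> q Sq lt_q; case: ltnP => [lt_qp|ge]; first exact: cross1.
  by have/inj_h -> : h q = h p by have := Sle q Sq; lia.
- move=> q t Sq hq lt_t; case: ltnP => [lt_tp|ge]; first exact: cross2 hq _.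
  by have := Sle q Sq; lia.
- move=> x y Sx Sy lt_xy lt_y cxy cyx ne theta_c.
  have [lt_yp|le_py] := ltnP (h y) (h p).
    apply: void => // t ht; rewrite -(theta_c t ht).
    by rewrite ifT //; lia.
  have [lt_xp|le_px] := ltnP (h x) (h p).
    have neq : h p <> h y by move=> /inj_h e1; rewrite -e1 Sp in Sy.
    by exists p => //; lia.
  have neq : h p <> h x by move=> /inj_h e1; rewrite -e1 Sp in Sx.
  have := theta_c (h x); rewrite ltnNge le_px /= leqnn ltnW // => /(_ isT) er.
  by have := empty_e x; have := empty_e y; lia.
Qed.

Lemma curve_cons S theta p r : 
  curve S theta (h p) -> (forall t, h p = t.+1 -> theta t = r) ->
  c p <= r <= (c p).+1 -> curve (p :: S) theta (h p).
Proof.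
move=> [jump cross1 cross2 void] theta_p rp; split.
- by move=> t lt_t noq; apply: jump => // q Sq; apply: noq; rewrite inE Sq orbT.
- by move=> q; rewrite inE => /predU1P[->|Sq]; [lia | apply: cross1].
- move=> q t; rewrite inE => /predU1P[->|Sq] hq; first by rewrite (theta_p _ hq).
  exact: cross2.
- move=> x y; rewrite !inE !negb_or => /andP[_ Sx] /andP[_ Sy] lt_xy lt_y cxy cyx ne th.
  have [q Sq hq] := void x y Sx Sy lt_xy lt_y cxy cyx ne th.
  by exists q; rewrite // inE Sq orbT.
Qed.

(** * Wave fronts rising through a window of columns *)

Section Wave.

Variables (a b : nat) (x0 : T).
Hypothesis lt_ab : a < b.
Hypothesis columns_inhabited : forall d, a <= d <= b -> exists x, c x = d.

Definition next_in d (P : nat -> bool) : T :=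
  odflt x0 [pick x | [&& c x == d, P (h x) &
                       [forall y, (c y == d) && P (h y) ==> (h x <= h y)]]].

Lemma next_inP d (P : nat -> bool) x : c x = d -> P (h x) ->
  [/\ c (next_in d P) = d, P (h (next_in d P)) &
      forall y, c y = d -> P (h y) -> h (next_in d P) <= h y].
Proof.
move=> cx Px; rewrite /next_in; case: pickP => [y /and3P[/eqP cy Py /forallP miny]|none].
  by split=> // z cz Pz; have := miny z; rewrite cz eqxx Pz.
have Pi : (c x == d) && P (h x) by rewrite cx eqxx Px.
have [y /andP[cy Py] miny] := @arg_minnP _ x [pred x | (c x == d) && P (h x)] h Pi.
have := none y; rewrite /= cy Py /=; move/negP; case; apply/forallP=> z.
by apply/implyP=> Pz; apply: miny.
Qed.

(** A new front point clears the old ones in all columns at distance at most one, as the rows of a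
    wall require; [maxn] and [minn] keep these columns inside the window. *)
Fixpoint front s d : T :=
  if s is s'.+1 then
    next_in d (fun t => [&& h (front s' (maxn a d.-1)) < t, h (front s' d) < t
                          & h (front s' (minn b d.+1)) < t])
  else next_in d xpredT.

(** The curve records the backtracking from the front point: one point of [S] per earlier row, each
    blocking the next. *)
Definition front_ok s := forall d, a <= d <= b ->
  c (front s d) = d /\
  exists S theta, [/\ size S <= s.+1, curve S theta (h (front s d)),
     front s d \in S, forall q, q \in S -> h q <= h (front s d) &
     forall t, a < theta t <= b].

Definition front_lt s := forall d d', a <= d <= b -> a <= d' <= b ->
  d <= d'.+1 -> d' <= d.+1 -> h (front s d) < h (front s.+1 d').

(** A curve confined to the gaps in (a, b] leaves column [a] on its left and column [b] on its
    right. *)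
Lemma gap_exists d e : a <= d <= b -> a <= e <= b -> d <= e.+1 -> e <= d.+1 ->
  exists r, [/\ a < r <= b, d <= r <= d.+1 & e <= r <= e.+1].
Proof.
move=> hd he de ed; have [lt|gt|eq] := ltngtP d e.
- by exists e; split; lia.
- by exists d; split; lia.
have [ea|na] := eqVneq d a; [exists a.+1 | exists d]; split; lia.
Qed.

Lemma front_ok0 : front_ok 0.
Proof.
move=> d hd; have [x cx] := columns_inhabited hd.
have [cf _ minf] := next_inP (P := xpredT) cx isT.
split=> //; have [r [r1 r2 _]] := gap_exists hd hd (leqnSn d) (leqnSn d).
(* [e] is the column on the other side of the gap [r]. *)
have [e [e1 e2 e3]] : exists e, [/\ r = maxn d e, d < e \/ e < d & d <= e.+1 /\ e <= d.+1].
  have [er|ne] := eqVneq r d; [exists d.-1 | exists r]; split; lia.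
exists [:: next_in d xpredT], (fun=> maxn d e); split=> //=.
- by apply: curve_start; try lia; move=> z; rewrite cf => cz; apply: minf.
- by rewrite inE.
- by move=> q; rewrite inE => /eqP ->.
- by rewrite -e1.
Qed.

Lemma front_step s : front_ok s ->
  (exists S right, size S <= s.+1 /\ separates a b S right) \/
  (front_ok s.+1 /\ front_lt s).
Proof.
move=> ok_s.
(* If column [e] has no point above this front point, the curve rises beside it beyond all heights
   and becomes a separator. *)
have stuck d e : a <= d <= b -> a <= e <= b -> d <= e.+1 -> e <= d.+1 ->
    (forall z, c z = e -> ~~ (h (front s d) < h z)) ->
    exists S right, size S <= s.+1 /\ separates a b S right.
  move=> hd he de ed none; have [cd [S [theta [szS crv Sf Sle thab]]]] := ok_s d hd.
  have [r [rab rd re]] := gap_exists hd he de ed.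
  pose t1 := (\max_z h z).+1.
  have lt_t1 z : h z < t1 by rewrite ltnS leq_bigmax.
  pose theta' t := if t < h (front s d) then theta t else r.
  have crv' : curve S theta' t1.
    apply: (curve_step (e := e)) => //; first by rewrite cd.
    by move=> z cz; have := none z cz; lia.
  have thab' t : a < theta' t <= b by rewrite /theta'; case: ifP.
  exists S, (fun z => theta' (h z) <= c z); split=> //; split.
  - by move=> x cx; have := thab' (h x); lia.
  - by move=> x cx; have := thab' (h x); lia.
  - by move=> x y Sx Sy adj; apply: curve_separates crv' lt_t1 Sx Sy adj.
have [[d [e [hd he [de ed] none]]]|full] :
    (exists d e, [/\ a <= d <= b, a <= e <= b, d <= e.+1 /\ e <= d.+1 &
       forall z, c z = e -> ~~ (h (front s d) < h z)]) \/
    (forall d e, a <= d <= b -> a <= e <= b -> d <= e.+1 -> e <= d.+1 ->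
       exists2 z, c z = e & h (front s d) < h z).
  pose bad d e := [&& a <= d <= b, a <= e <= b, d <= e.+1, e <= d.+1 &
                     [forall z, (c z == e) ==> ~~ (h (front s d) < h z)]].
  have [bd|good] := boolP [exists d : 'I_b.+1, [exists e : 'I_b.+1, bad d e]].
    case/existsP: bd => d /existsP[e /and5P[hd he de ed /forallP none]].
    left; exists d, e; split=> // z cz.
    by have := none z; rewrite cz eqxx.
  right=> d e hd he de ed.
  have [ltd lte] : d < b.+1 /\ e < b.+1 by lia.
  move: good; rewrite negb_exists => /forallP/(_ (Ordinal ltd)).
  rewrite negb_exists => /forallP/(_ (Ordinal lte)).
  rewrite /bad /= hd he de ed /= negb_forall => /existsP[z].
  by rewrite negb_imply negbK => /andP[/eqP cz lt]; exists z.
- by left; apply: (stuck d e).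
have spec e : a <= e <= b ->
  [/\ c (front s.+1 e) = e,
      forall d, a <= d <= b -> d <= e.+1 -> e <= d.+1 -> h (front s d) < h (front s.+1 e) &
      exists d, [/\ a <= d <= b, d <= e.+1, e <= d.+1 &
        forall z, c z = e -> ~~ (h (front s d) < h z < h (front s.+1 e))]].
  move=> he /=; set P := fun t => _.
  set l := maxn a e.-1; set r := minn b e.+1.
  (* Only the highest of the three old points matters. Column [e] is empty between it and the new
     point, which is what extends the curve. *)
  have [d [hd de ed Pd]] : exists d, [/\ a <= d <= b, d <= e.+1, e <= d.+1 &
      forall t, P t = (h (front s d) < t)].
    rewrite /P -/l -/r; have [l1 r1] : a <= l <= b /\ a <= r <= b by lia.
    have [m1|m1] := leqP (h (front s l)) (h (front s e)).
      have [m2|m2] := leqP (h (front s r)) (h (front s e)); [exists e | exists r];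
      by split=> //; try lia; move=> t; lia.
    have [m2|m2] := leqP (h (front s r)) (h (front s l)); [exists l | exists r];
    by split=> //; try lia; move=> t; lia.
  have [z cz hz] := full d e hd he de ed.
  have [//|cn Pn minn] := next_inP (P := P) cz; first by rewrite Pd.
  split=> //.
    move=> d' hd' de' ed'; move: Pn; rewrite /P -/l -/r => /and3P[p1 p2 p3].
    have [lt1|lt1|->//] := ltngtP d' e.
      by have -> : d' = l by lia.
    by have -> : d' = r by lia.
  exists d; split=> // w cw; rewrite -Pd; apply/negP=> /andP[Pw].
  by have := minn w cw Pw; lia.
right; split; last by move=> d e hd he de ed; have [_ lt _] := spec e he; apply: lt.
move=> e he; have [ce _ [d [hd de ed none]]] := spec e he; split=> //.
have [cd [S [theta [szS crv Sf Sle thab]]]] := ok_s d hd.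
have [r [rab rd re]] := gap_exists hd he de ed.
set p := front s.+1 e in ce none *.
have lt_p : h (front s d) < h p by have [_ lt _] := spec e he; apply: lt.
exists (p :: S), (fun t => if t < h (front s d) then theta t else r); split=> //.
- apply: (curve_cons (r := r)); last by rewrite ce.
    by apply: (curve_step (e := e)); rewrite ?cd.
  by move=> t ht; rewrite ifF //; lia.
- by rewrite inE eqxx.
- by move=> q; rewrite inE => /predU1P[->//|/Sle]; lia.
- by move=> t; case: ifP.
Qed.

End Wave.

Lemma separator_or_wall a b s : a < b ->
  (exists S right, size S <= s /\ separates a b S right) \/
  exists Y : nat -> nat -> T,
    (forall t d, t <= s -> a <= d <= b -> c (Y t d) = d) /\
    (forall t d d', t < s -> a <= d <= b -> a <= d' <= b ->
       d <= d'.+1 -> d' <= d.+1 -> h (Y t d) < h (Y t.+1 d')).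
Proof.
move=> lt_ab.
have [none|inh] := boolP [exists d : 'I_b.+1, (a <= d) && [forall x, c x != d]].
  (* An empty column separates without any point: no ladder-adjacent pair jumps over it. *)
  case/existsP: none => d /andP[le_ad /forallP none]; left.
  exists [::], (fun z => d <= c z); split=> //; split.
  - by move=> x cx; have := none x; lia.
  - by move=> x cx; have := ltn_ord d; lia.
  - by move=> x y _ _ [_ cxy cyx _]; have := none x; have := none y; lia.
have columns_inhabited d : a <= d <= b -> exists x, c x = d.
  move=> hd; have ltd : d < b.+1 by lia.
  move: inh; rewrite negb_exists => /forallP/(_ (Ordinal ltd)) /=.
  rewrite (andP hd).1 /= negb_forall => /existsP[x]; rewrite negbK => /eqP cx.
  by exists x.
have [x0 _] : exists x, c x = a by apply: columns_inhabited; lia.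
suff [?|[ok lt]] : (exists S right, size S <= s /\ separates a b S right) \/
  (forall t, t <= s -> front_ok a b x0 t) /\ (forall t, t < s -> front_lt a b x0 t).
- by left.
- right; exists (front a b x0); split=> [t d le_t hd|t d d' lt_t]; last exact: lt.
  by have [] := ok t le_t d hd.
elim: s => [|s [[S [r [szS sep]]]|[ok lt]]].
- right; split=> // t; rewrite leqn0 => /eqP ->.
  exact: front_ok0.
- by left; exists S, r; split=> //; apply: ltnW.
have [[S [r [szS sep]]]|[ok1 lt1]] := front_step lt_ab (ok s (leqnn s)).
  by left; exists S, r.
right; split=> t; rewrite leq_eqVlt => /predU1P[e|] //.
- by rewrite e.
- by rewrite ltnS; apply: ok.
- by case: e => ->.
- by rewrite !ltnS; apply: lt.
Qed.

End Separators.

(** * Path decompositions *)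

(** Send a point of sigma to the wall point in row [h'] and column [a + c']. Since [a] is even, the
    shift respects both pairings of columns into strips; rows only have to be compared in columns at
    distance at most one. *)
Lemma wall_contains k (pi : 'S_k) c h m (sigma : 'S_m) c' h' a b
    (Y : nat -> nat -> 'I_k) :
  staircase pi c h -> staircase sigma c' h' -> ~~ odd a -> a + m <= b ->
  (forall t d, t <= m -> a <= d <= b -> c (Y t d) = d) ->
  (forall t d d', t < m -> a <= d <= b -> a <= d' <= b ->
     d <= d'.+1 -> d' <= d.+1 -> h (Y t d) < h (Y t.+1 d')) ->
  contains pi sigma.
Proof.
move=> [_ _ pos val] [[inj' h'_lt] [c'_le _] pos' val'] even_a le_b cY hY.
have mono t t' d d' : t < t' -> t' <= m -> a <= d <= b -> a <= d' <= b ->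
    d <= d'.+1 -> d' <= d.+1 -> h (Y t d) < h (Y t' d').
  elim: t' d' => // t' IHt d'; rewrite ltnS leq_eqVlt => /predU1P[<-|lt_t] lt_m hd hd' dd' d'd.
    exact: hY.
  have lt1 := IHt d lt_t (ltnW lt_m) hd hd (leqnSn d) (leqnSn d).
  by apply: ltn_trans lt1 _; apply: hY.
pose f q := Y (h' q) (a + c' q).
have hc q : a <= a + c' q <= b by have := c'_le q; lia.
have cf q : c (f q) = a + c' q by apply: cY => //; apply: ltnW.
have hf p q : c' p <= (c' q).+1 -> c' q <= (c' p).+1 -> (h (f p) < h (f q)) = (h' p < h' q).
  move=> pq qp; have [lt|gt|/inj' ->] := ltngtP (h' p) (h' q); last by rewrite ltnn.
    by apply: mono => //; [exact: ltnW | lia | lia].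
  have : h (f q) < h (f p) by apply: mono => //; [exact: ltnW | lia | lia].
  lia.
have hfE p q : lex half c h (f p) (f q) = lex half c' h' p q.
  by rewrite /lex !cf; have := hf p q; lia.
have ufE p q : lex uphalf c h (f p) (f q) = lex uphalf c' h' p q.
  by rewrite /lex !cf; have := hf p q; lia.
exists f; split=> [p q|p q]; last by rewrite val ufE val'.
by rewrite pos hfE -pos'.
Qed.

Definition convex (T : finType) (B : nat -> {set T}) : Prop :=
  forall x t1 t t2, x \in B t1 -> x \in B t2 -> t1 <= t <= t2 -> x \in B t.

Definition consecutive (T : Type) (lt : rel T) x y : Prop :=
  lt x y /\ forall z, ~~ (lt x z && lt z y).

Section PathDecomposition.

Variables (T : finType) (c h : T -> nat) (H M L : nat).
Hypothesis inj_h : injective h.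
Hypothesis h_lt : forall x, h x < H.
Hypothesis c_pred : forall x, 1 < c x -> exists y, (c y).+1 = c x.
Hypothesis M_ge4 : 4 <= M.
Hypothesis separator : forall w, exists S right,
  size S <= L /\ separates c h (w * M) (w * M + M.-1) S right.

Definition is_bottom x := [forall y, (c y == c x) ==> (h x <= h y)].
Definition is_top x := [forall y, (c y == c x) ==> (h y <= h x)].

(** Inside a strip, a point between the two in either column would come between them in the order
    too. Across strips, [x] must end its column and [y] must start its own. *)
Lemma consecutive_cases (b : nat -> nat) x y : b = half \/ b = uphalf ->
  consecutive (lex b c h) x y ->
  ladder_adjacent c h x y \/
  [/\ is_top x, is_bottom y, c x <= c y & c y <= c x + 3].
Proof.
move=> hb [lt_xy noz].
have b_lt i j : b i < b j -> i < j by case: hb => ->; lia.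
have b_eq i j : b i = b j -> i <= j.+1 /\ j <= i.+1 by case: hb => ->; lia.
have b_far i j : i.+2 <= j -> b i < b j by case: hb => ->; lia.
have [lt_b|/andP[/eqP eq_b lt_h]] := orP lt_xy; [right|left].
  split; last 1 first.
  (* Four or more columns apart, a point two columns before [y] would lie in a strip strictly
     between. *)
  - rewrite leqNgt; apply/negP=> far.
    have [|y1 cy1] := c_pred (x := y); first by lia.
    have [|y2 cy2] := c_pred (x := y1); first by lia.
    have := noz y2; rewrite /lex !b_far //; lia.
  - apply/forallP=> z; apply/implyP=> /eqP cz; rewrite leqNgt; apply/negP=> lt_z.
    by have := noz z; rewrite /lex cz eqxx lt_z lt_b orbT.
  - apply/forallP=> z; apply/implyP=> /eqP cz; rewrite leqNgt; apply/negP=> lt_z.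
    by have := noz z; rewrite /lex cz eqxx lt_z lt_b orbT.
  - exact/ltnW/b_lt.
have [cxy cyx] := b_eq _ _ eq_b; split=> // z cz; apply/negP=> /andP[lt1 lt2].
have := noz z; rewrite /lex lt1 lt2.
by case/orP: cz => /eqP ->; rewrite eq_b eqxx !orbT.
Qed.

Let sep w := constructive_indefinite_description _ (separator w).
Let S w := sval (sep w).
Let sepr w := constructive_indefinite_description _ (svalP (sep w)).
Let right w := sval (sepr w).

Let size_S w : size (S w) <= L.
Proof. by have [] := svalP (sepr w). Qed.

Let S_separates w : separates c h (w * M) (w * M + M.-1) (S w) (right w).
Proof. by have [] := svalP (sepr w). Qed.

Definition window x := c x %/ M.
Definition special x := [|| x \in S (window x), is_bottom x | is_top x].
(** Region r lies between the separators of the windows r - 1 and r. *)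
Definition region x := window x + right (window x) x.

(* Time [t] stands for height [t %% H] in the sweep of region [t %/ H]. *)
Definition bag t : {set T} :=
  [set x | if special x then window x <= t %/ H <= (window x).+1
           else [&& t %/ H == region x, h x <= t %% H &
             [forall y, (c y == c x) && (h x < h y) ==> (t %% H <= h y)]]].

Lemma bag_convex : convex bag.
Proof.
move=> x t1 t t2; rewrite !inE; case: ifP => _.
  move=> /andP[a1 a2] /andP[a3 a4] /andP[le1 le2].
  by have := leq_div2r H le1; have := leq_div2r H le2; lia.
move=> /and3P[/eqP a1 a2 _] /and3P[/eqP a4 _ /forallP a6] /andP[le1 le2].
have d1 := leq_div2r H le1; have d2 := leq_div2r H le2.
have e : t %/ H = region x by lia.
have := divn_eq t1 H; have := divn_eq t H; have := divn_eq t2 H.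
rewrite a1 a4 e => e2 e0 e1; rewrite eqxx /=; apply/andP; split; first by lia.
by apply/forallP=> y; apply/implyP=> Py; have := a6 y; rewrite Py /=; lia.
Qed.

(** A column contributes its bottom, its top, its last point up to height [u], and its last point
    strictly below [u]: the latter is still held when the next point has height exactly [u]. Region
    [r] meets only the windows [r] and [r.-1], whence the factor 2. *)
Lemma card_bag t : #|bag t| <= (L + 4 * M) * 2.
Proof.
pose r := t %/ H; pose u := t %% H.
pose F1 d := [set x | (c x == d) && is_bottom x].
pose F2 d := [set x | (c x == d) && is_top x].
pose F3 d := [set x | [&& c x == d, h x <= u &
  [forall y, (c y == c x) && (h y <= u) ==> (h y <= h x)]]].
pose F4 d := [set x | [&& c x == d, h x < u &
  [forall y, (c y == c x) && (h y < u) ==> (h y <= h x)]]].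
pose F d := F1 d :|: F2 d :|: F3 d :|: F4 d.
have card1 (A : {set T}) : (forall x y, x \in A -> y \in A -> h x <= h y) -> #|A| <= 1.
  move=> le_A; apply/card_le1_eqP => x y Ax Ay; apply: inj_h; apply/eqP.
  by rewrite eqn_leq !le_A.
have c1 d : #|F1 d| <= 1.
  apply: card1 => x y; rewrite !inE => /andP[/eqP cx /forallP/(_ y)] + /andP[/eqP cy _].
  by rewrite cx cy eqxx.
have c2 d : #|F2 d| <= 1.
  apply: card1 => y x; rewrite !inE => /andP[/eqP cy _] /andP[/eqP cx /forallP/(_ y)].
  by rewrite cx cy eqxx.
have c3 d : #|F3 d| <= 1.
  apply: card1 => y x; rewrite !inE => /and3P[/eqP cy hy _] /and3P[/eqP cx _ /forallP/(_ y)].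
  by rewrite cx cy eqxx hy.
have c4 d : #|F4 d| <= 1.
  apply: card1 => y x; rewrite !inE => /and3P[/eqP cy hy _] /and3P[/eqP cx _ /forallP/(_ y)].
  by rewrite cx cy eqxx hy.
have cF d : #|F d| <= 4.
  have [u1 _] := leq_card_setU (F1 d :|: F2 d :|: F3 d) (F4 d).
  have [u2 _] := leq_card_setU (F1 d :|: F2 d) (F3 d).
  have [u3 _] := leq_card_setU (F1 d) (F2 d).
  by have := c1 d; have := c2 d; have := c3 d; have := c4 d; rewrite /F; lia.
pose W w := [set x in S w] :|: \bigcup_(i < M) F (w * M + i).
have cW w : #|W w| <= L + 4 * M.
  apply: leq_trans (leq_card_setU _ _) _; apply: leq_add.
    by rewrite cardsE; apply: leq_trans (card_size _) (size_S w).
  have cB (I : finType) (G : I -> {set T}) : #|\bigcup_i G i| <= \sum_i #|G i|.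
    apply: (big_ind2 (fun (A : {set T}) n => #|A| <= n)); rewrite ?cards0 //.
    by move=> A1 n1 A2 n2 le1 le2; apply: leq_trans (leq_card_setU _ _) (leq_add le1 le2).
  apply: leq_trans (cB _ _) _.
  apply: leq_trans (leq_sum _ (fun i _ => cF _)) _.
  by rewrite sum_nat_const card_ord mulnC.
suff sub : bag t \subset W r :|: W r.-1.
  apply: leq_trans (subset_leq_card sub) _.
  apply: leq_trans (leq_card_setU _ _) _.
  by have := cW r; have := cW r.-1; lia.
apply/subsetP=> x; rewrite inE => Bx.
suff [Wx wx] : x \in W (window x) /\ (window x == r) || (window x == r.-1).
  by rewrite inE; case/orP: wx => /eqP <-; rewrite Wx ?orbT.
split; last first.
  move: Bx; rewrite -/r; case: ifP => _; first by lia.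
  by case/and3P => /eqP + _ _; rewrite /region; case: (right _ _); lia.
have inF : x \in F (c x) -> x \in W (window x).
  move=> Fx; rewrite inE; apply/orP; right.
  have lt_m : c x %% M < M by rewrite ltn_mod; lia.
  apply/bigcupP; exists (Ordinal lt_m) => //=.
  by rewrite /window -divn_eq.
move: Bx; rewrite /special; have [Sx|_] := boolP (x \in S (window x)).
  by move=> _; rewrite !inE Sx.
have [bx _|_] := boolP (is_bottom x).
  by apply: inF; rewrite !inE eqxx bx.
have [tx _|_] := boolP (is_top x).
  by apply: inF; rewrite !inE eqxx tx !orbT.
move=> /= /and3P[_ hx /forallP mx]; apply: inF; rewrite !inE !eqxx hx /=.
have [/forallP f3|/forallPn[y]] :=
  boolP [forall y, (c y == c x) && (h y <= u) ==> (h y <= h x)].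
  by rewrite orbT.
(* [x] is held no longer than up to the next height in its column, so [y] sits exactly at [u]. *)
rewrite negb_imply -ltnNge => /andP[/andP[cy hy] lt_xy].
have {}hy : h y = u by have := mx y; rewrite cy lt_xy /= -/u; lia.
apply/orP; right; apply/andP; split; first by rewrite -/u; lia.
apply/forallP=> z; apply/implyP=> /andP[cz hz]; rewrite leqNgt; apply/negP=> lt_xz.
by have := mx z; rewrite cz lt_xz /=; rewrite -/u; lia.
Qed.

Let H_gt0 (x : T) : 0 < H.
Proof. exact: leq_ltn_trans (h_lt x). Qed.

Let time_div r (x : T) : (r * H + h x) %/ H = r.
Proof. by rewrite divnMDl ?(H_gt0 x) // divn_small ?addn0. Qed.

Let time_mod r (x : T) : (r * H + h x) %% H = h x.
Proof. by rewrite modnMDl modn_small. Qed.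

Lemma bag_self x r : (if special x then window x <= r <= (window x).+1 else r == region x) ->
  x \in bag (r * H + h x).
Proof.
rewrite inE time_div time_mod; case: ifP => // _ /eqP ->; rewrite eqxx leqnn /=.
by apply/forallP=> y; apply/implyP=> /andP[_ /ltnW].
Qed.

Lemma bag_special x y r : special x -> window x <= r <= (window x).+1 ->
  x \in bag (r * H + h y).
Proof. by rewrite inE time_div => ->. Qed.

Lemma bag_cover x : exists t, x \in bag t.
Proof.
exists ((if special x then window x else region x) * H + h x); apply: bag_self.
by case: (special x); rewrite ?eqxx ?leqnn ?leqnSn.
Qed.

Let window_bounds x : window x * M <= c x < window x * M + M.
Proof.
rewrite leq_trunc_div /=; have := @ltn_ceil (c x) M; rewrite mulSn addnC; apply; lia.
Qed.

Let window_near x y : c x <= c y -> c y <= c x + M -> window x <= window y <= (window x).+1.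
Proof.
move=> le1 le2; rewrite /window leq_div2r //=.
by apply: leq_trans (leq_div2r M le2) _; rewrite divnDr // divnn (_ : 0 < M) ?addn1; lia.
Qed.

Let region_bounds x : window x <= region x <= (window x).+1.
Proof. by rewrite /region; case: right; lia. Qed.

(** If the windows differ, [x] lies in an outermost column of its window, whose side is prescribed;
    this places it in the region shared by both windows. *)
Let region_near x y : c x <= (c y).+1 -> c y <= (c x).+1 ->
  window y <= region x <= (window y).+1.
Proof.
move=> cxy cyx; have [lt|gt|<-] := ltngtP (window x) (window y); last exact: region_bounds.
- have e : window y = (window x).+1.
    have := window_bounds x; have := window_bounds y => wy wx.
    by have /andP[_] := @window_near x y ltac:(nia) ltac:(lia); lia.
  have cx : c x = window x * M + M.-1.
    by have := window_bounds x; have := window_bounds y; rewrite e mulSn; lia.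
  have [_ /(_ x cx) rx _] := S_separates (window x).
  by rewrite /region rx e; lia.
- have e : window x = (window y).+1.
    have := window_bounds x; have := window_bounds y => wy wx.
    by have /andP[_] := @window_near y x ltac:(nia) ltac:(lia); lia.
  have cx : c x = window x * M.
    by have := window_bounds x; have := window_bounds y; rewrite e mulSn; lia.
  have [/(_ x cx) rx _ _] := S_separates (window x).
  by rewrite /region (negPf rx) e; lia.
Qed.

Let region_eq x y : ~~ special x -> ~~ special y -> ladder_adjacent c h x y ->
  region x = region y.
Proof.
rewrite /special !negb_or => /and3P[Sx _ _] /and3P[Sy _ _] adj.
have [_ cxy cyx _] := adj.
have [e|ne] := eqVneq (window x) (window y).
  have [_ _ sepxy] := S_separates (window x).
  by rewrite /region -e (sepxy x y) //; rewrite e.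
have := region_near cxy cyx; have := region_near cyx cxy.
have := region_bounds x; have := region_bounds y.
by lia.
Qed.

Lemma bag_edge (b : nat -> nat) x y : b = half \/ b = uphalf ->
  consecutive (lex b c h) x y -> exists t, x \in bag t /\ y \in bag t.
Proof.
move=> hb /(consecutive_cases hb)[adj|[tx by_ cxy cyx]]; last first.
  have := @window_near x y cxy ltac:(lia) => wxy.
  exists (window y * H + h y); split.
    by apply: bag_special; rewrite // /special tx !orbT.
  by apply: bag_special; rewrite ?leqnn ?leqnSn // /special by_ !orbT.
have [lt_h cxy cyx noz] := adj.
have [sx|sx] := boolP (special x); have [sy|sy] := boolP (special y).
- have [le|lt] := leqP (c x) (c y).
    have wxy := @window_near x y le ltac:(lia).
    exists (window y * H + h y); split; apply: bag_special => //; lia.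
  have wxy := @window_near y x ltac:(lia) ltac:(lia).
  exists (window x * H + h y); split; apply: bag_special => //; lia.
- exists (region y * H + h y); split.
    by apply: bag_special => //; apply: region_near.
  by apply: bag_self; rewrite (negPf sy).
- exists (region x * H + h x); split.
    by apply: bag_self; rewrite (negPf sx).
  by apply: bag_special => //; apply: region_near.
(* The lower point is still in the bag at the height of the upper one, because its column has no
   point in between. *)
- exists (region x * H + h y); split; last first.
    by apply: bag_self; rewrite (negPf sy) (region_eq sx sy adj).
  rewrite inE (negPf sx) time_div time_mod eqxx ltnW //=.
  apply/forallP=> z; apply/implyP=> /andP[cz lt]; rewrite leqNgt; apply/negP=> lt2.
  by have := noz z; rewrite cz lt lt2 => /(_ isT).
Qed.

End PathDecomposition.

Definition path_decomposition k (pi : 'S_k) (K : nat) (B : nat -> {set 'I_k}) : Prop :=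
  [/\ forall t, #|B t| <= K, convex B, forall x, exists t, x \in B t,
      forall x y : 'I_k, y = x.+1 :> nat -> exists t, x \in B t /\ y \in B t &
      forall x y, pi y = (pi x).+1 :> nat -> exists t, x \in B t /\ y \in B t].

Lemma bounded_pathwidth m (sigma : 'S_m) : C20 sigma ->
  exists K, forall k (pi : 'S_k), C20 pi -> ~ contains pi sigma ->
    exists B, path_decomposition pi K B.
Proof.
move=> sig20; have [c' [h' st']] := staircase_exists sig20.
(* [M] is even so that every window starts at an even column, and large enough for a window to hold
   the columns of sigma. *)
pose M := (m + 4).*2; exists ((m + 4 * M) * 2) => k pi pi20 avoid.
have [c [h st]] := staircase_exists pi20; have [[inj_h h_lt] [_ c_pred] pos val] := st.
have separator w : exists S right,
  size S <= m /\ separates c h (w * M) (w * M + M.-1) S right.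
  have lt_w : w * M < w * M + M.-1 by rewrite /M; lia.
  have [//|[Y [cY hY]]] := separator_or_wall c inj_h m lt_w.
  case: avoid; apply: (wall_contains st st' _ _ cY hY); last by rewrite /M; lia.
  by rewrite oddM /M odd_double andbF.
have M4 : 4 <= M by rewrite /M; lia.
exists (bag k separator); split.
- by move=> t; apply: card_bag.
- exact: bag_convex.
- by move=> x; apply: bag_cover.
- move=> x y e; apply: (bag_edge h_lt c_pred M4 separator (b := half)); first by left.
  by split=> [|z]; rewrite -!pos e // ltnS; lia.
- move=> x y e; apply: (bag_edge h_lt c_pred M4 separator (b := uphalf)); first by right.
  by split=> [|z]; rewrite -!val e // ltnS; lia.
Qed.

(** * The pebble game *)

Lemma ord_homo_succ k (f : 'I_k -> nat) :
  (forall x y : 'I_k, y = x.+1 :> nat -> f x < f y) -> {homo f : x y / x < y}.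
Proof.
move=> succ x y; have [m] := ubnP (nat_of_ord y); elim: m y => // m IHm y le_m lt_xy.
have [e|ne] := eqVneq (nat_of_ord y) x.+1; first exact: succ.
have lt_p : y.-1 < k by have := ltn_ord y; lia.
apply: (ltn_trans (IHm (Ordinal lt_p) _ _)); [rewrite /=; lia.. | ].
by apply: succ => /=; lia.
Qed.

Section Pebbles.

Variables (k n K : nat) (pi : 'S_k) (tau : 'S_n).

Definition order_compatible (x y : 'I_k) (u v : 'I_n) : Prop :=
  (u < v) = (x < y) /\ (tau u < tau v) = (pi x < pi y).

Definition pebbling : Type := {ffun 'I_K -> 'I_k * 'I_n}.

Definition move_pebble (q : pebbling) (i : 'I_K) x y : pebbling :=
  [ffun j => if j == i then (x, y) else q j].

Variable A : pebbling -> Prop.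
Hypothesis A_compat : forall q, A q -> forall i j,
  order_compatible (q i).1 (q j).1 (q i).2 (q j).2.
Hypothesis A_move : forall q i x, A q -> exists y, A (move_pebble q i x y).

Definition covered (C : {set 'I_k}) (q : pebbling) (g : 'I_k -> 'I_n) : Prop :=
  forall x, x \in C -> exists i, q i = (x, g x).

(** While some point of [D] is uncovered, fewer than [K] pebbles are needed to hold [C], so one is
    free to move there. Images outside [D :\: C] never change. *)
Lemma pebbles_cover (C D : {set 'I_k}) q g :
  C \subset D -> #|D| <= K -> A q -> covered C q g ->
  exists q' g', [/\ A q', covered D q' g' & forall x, x \notin D :\: C -> g' x = g x].
Proof.
move=> subCD cardD; have [m] := ubnP #|D :\: C|.
elim: m C q g subCD => // m IHm C q g subCD le_m Aq covC.
have [/eqP|] := set_0Vmem (D :\: C).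
  rewrite setD_eq0 => subDC; exists q, g; split=> // x Dx.
  by apply: covC; apply: (subsetP subDC).
case=> x; rewrite inE => /andP[Cx Dx].
have [f Pf] : exists f : 'I_k -> option 'I_K,
    forall y, y \in C -> exists2 i, f y = Some i & q i = (y, g y).
  exists (fun y => [pick i | q i == (y, g y)]) => y /covC[i qi].
  case: pickP => [j /eqP qj|/(_ i)]; first by exists j.
  by rewrite qi eqxx.
have [i fi] : exists i, forall y, y \in C -> f y != Some i.
  have lt_card : #|[set f y | y in C]| < #|[set Some i | i : 'I_K]|.
    apply: leq_ltn_trans (leq_imset_card _ _) _.
    rewrite card_imset; last by move=> a b [].
    rewrite card_ord; apply: leq_trans cardD.
    by apply: proper_card; apply/properP; split=> //; exists x.
  have /subsetPn[z] : ~~ ([set Some i | i : 'I_K] \subset [set f y | y in C]).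
    by apply/negP=> /subset_leq_card; lia.
  case/imsetP=> i _ -> nfi; exists i => y Cy.
  by apply: contraNneq nfi => <-; apply: imset_f.
have [y Ay] := A_move i x Aq.
pose g1 z := if z == x then y else g z.
have [||||q' [g' [Aq' cov' gE]]] := IHm (x |: C) (move_pebble q i x y) g1 => //.
- by rewrite subUset sub1set Dx.
- rewrite -ltnS; apply: leq_trans le_m; apply: proper_card.
  apply/properP; split; first by apply: setDS; rewrite subsetUr.
  by exists x; rewrite !inE ?eqxx ?Cx.
- move=> z; rewrite !inE => /predU1P[->|Cz].
    by exists i; rewrite ffunE eqxx /g1 eqxx.
  have [j fj qj] := Pf z Cz; exists j; rewrite ffunE.
  case: eqP => [e|_]; first by have := fi z Cz; rewrite fj e eqxx.
  rewrite /g1; case: eqP => // e; by rewrite -e Cz in Cx.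
exists q', g'; split=> // z nz; rewrite gE.
  rewrite /g1; case: eqP => // e; by rewrite e !inE Cx Dx in nz.
by apply: contra nz; rewrite !inE negb_or => /andP[/andP[_ ->]].
Qed.

(** Carry the pebbles from bag to bag. By convexity a point that has left the bags never returns, so
    its image is final. Every consecutive pair shares a bag and is therefore mapped in the right
    order; transitivity extends this to all pairs. *)
Lemma pebbles_contains (B : nat -> {set 'I_k}) :
  path_decomposition pi K B -> (exists q, A q) -> contains tau pi.
Proof.
move=> [cardB convB coverB posB valB] [q0 Aq0].
have [x0 _|nox] := pickP 'I_k; last first.
  have nof (x : 'I_k) : 'I_n by have := nox x.
  by exists nof; split=> [a|a]; have := nox a.
have K_gt0 : 0 < K.
  have [t Bt] := coverB x0; apply: leq_trans (cardB t).
  by apply/card_gt0P; exists x0.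
have sweep t : exists q g, [/\ A q, covered (B t) q g &
    forall s, s <= t -> forall x y, x \in B s -> y \in B s ->
      order_compatible x y (g x) (g y)].
  have compat q g D x y : A q -> covered D q g -> x \in D -> y \in D ->
      order_compatible x y (g x) (g y).
    move=> Aq cov /cov[i qi] /cov[j qj].
    by have := A_compat Aq i j; rewrite qi qj.
  elim: t => [|t [q [g [Aq cov cmp]]]].
    pose g0 (_ : 'I_k) := (q0 (Ordinal K_gt0)).2.
    have [|q [g [Aq cov _]]] := @pebbles_cover set0 (B 0) q0 g0 (sub0set _) (cardB 0) Aq0.
      by move=> x; rewrite inE.
    exists q, g; split=> // s; rewrite leqn0 => /eqP -> x y Bx By.
    exact: compat Aq cov Bx By.
  have [|q' [g' [Aq' cov' gE]]] :=
    @pebbles_cover (B t :&: B t.+1) (B t.+1) q g (subsetIr _ _) (cardB t.+1) Aq.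
    by move=> x; rewrite inE => /andP[/cov].
  exists q', g'; split=> // s; rewrite leq_eqVlt => /predU1P[->|lt_s] x y Bx By.
    exact: compat Aq' cov' Bx By.
  have old z : z \in B s -> g' z = g z.
    move=> Bz; apply: gE; rewrite !inE; apply/negP=> /andP[nB Bz1].
    by have := convB z s t t.+1 Bz Bz1; rewrite Bz1 andbT in nB; rewrite (negPf nB); lia.
  by rewrite !old //; apply: (cmp s).
(* There are finitely many pairs, so one final time suffices for all of them. *)
have [tm tmP] : exists tm, forall x y, (exists t, x \in B t /\ y \in B t) ->
    exists2 t, t <= tm & x \in B t /\ y \in B t.
  have [f Pf] : exists f : 'I_k * 'I_k -> nat, forall p,
      (exists t, p.1 \in B t /\ p.2 \in B t) -> p.1 \in B (f p) /\ p.2 \in B (f p).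
    apply: (fin_all_exists (P := fun p s => (exists t, p.1 \in B t /\ p.2 \in B t) ->
      p.1 \in B s /\ p.2 \in B s)) => p.
    by have [[t Pt]|no] := classic (exists t, p.1 \in B t /\ p.2 \in B t);
      [exists t | exists 0].
  exists (\max_p f p) => x y Pxy; exists (f (x, y)); first exact: leq_bigmax.
  exact: (Pf (x, y)).
have [q [g [_ _ cmp]]] := sweep tm.
have share x y : (exists t, x \in B t /\ y \in B t) -> order_compatible x y (g x) (g y).
  by case/tmP=> t le_t [Bx By]; apply: cmp le_t _ _ Bx By.
have pos : {homo g : x y / x < y}.
  apply: (@ord_homo_succ _ (fun x => g x)) => x y e.
  by have [-> _] := share _ _ (posB _ _ e); lia.
have val : {homo (fun v => tau (g (pi^-1%g v))) : x y / x < y}.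
  apply: (@ord_homo_succ _ (fun v => tau (g (pi^-1%g v)))) => u v e.
  have [_ ->] : order_compatible (pi^-1%g u) (pi^-1%g v) (g (pi^-1%g u)) (g (pi^-1%g v)).
    by apply/share/valB; rewrite !permKV.
  by rewrite !permKV; lia.
have {}val x y : pi x < pi y -> tau (g x) < tau (g y).
  by move/val; rewrite !permK.
exists g; split=> // x y.
have [/val //|/val lt|/val_inj/perm_inj ->] := ltngtP (pi x) (pi y); last by rewrite ltnn.
by lia.
Qed.

End Pebbles.

(** * Consistency tables *)

Fixpoint words (N m : nat) : seq (seq nat) :=
  if m is m'.+1 then [seq i :: w | i <- iota 0 N, w <- words N m'] else [:: [::]].

Lemma mem_words N m l : (l \in words N m) = (size l == m) && all (fun d => d < N) l.
Proof.
elim: m l => [|m IHm] l; first by rewrite inE -size_eq0; case: l.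
apply/allpairsP/idP => [[[i w] /= [iN wm ->]]|].
  move: iN wm; rewrite mem_iota IHm /= add0n => -> /andP[/eqP -> ->].
  by rewrite eqxx.
case: l => // i w /= /andP[sz /andP[lt_i all_w]]; exists (i, w); split=> //=.
  by rewrite mem_iota.
by rewrite IHm all_w -eqSS sz.
Qed.

(** Base [N] with a leading digit 1: codes are positive, which leaves cell 0 of the table free. *)
Definition enc (N : nat) (l : seq nat) : nat := foldl (fun a d => a * N + d) 1 l.

Lemma enc_gt0 N l : 0 < N -> 0 < enc N l.
Proof.
move=> N_gt0; rewrite /enc.
suff gt0 a : 0 < a -> 0 < foldl (fun a d => a * N + d) a l by apply: gt0.
elim: l a => //= d l IHl a a_gt0; apply: IHl.
by rewrite addn_gt0 muln_gt0 a_gt0 N_gt0.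
Qed.

Lemma enc_inj N m : {in words N m &, injective (enc N)}.
Proof.
move=> l l'; rewrite !mem_words /enc => /andP[/eqP szl al] /andP[/eqP szl' al'].
rewrite -{m}szl' in szl; elim/last_ind: l l' szl al al' => [|l d IHl] l'.
  by move/esym/size0nil ->.
case/lastP: l' => [|l' d']; first by rewrite size_rcons.
rewrite !size_rcons => -[sz]; rewrite !all_rcons => /andP[ltd al] /andP[ltd' al'].
rewrite !foldl_rcons => e.
have N_gt0 : 0 < N by lia.
have ed : d = d'.
  by have := congr1 (modn^~ N) e; rewrite !modnMDl !modn_small.
rewrite ed in e *; congr rcons; apply: IHl => //.
by move/eqP: e; rewrite eqn_add2r eqn_pmul2r // => /eqP.
Qed.

Section Consistency.

Variables (k n K N : nat) (inp : nat -> nat).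
Hypotheses (le_kN : k <= N) (le_nN : n <= N).

(** A word lists the pattern positions of the [K] pebbles and then their text positions. The offsets
    2 and [2 + k] are where [encode] puts the two permutations. *)
Definition valid (l : seq nat) : bool :=
  [&& all (fun i => nth 0 l i < k) (iota 0 K),
      all (fun i => nth 0 l (K + i) < n) (iota 0 K) &
      all (fun i => all (fun j =>
        ((nth 0 l (K + i) < nth 0 l (K + j)) == (nth 0 l i < nth 0 l j)) &&
        ((inp (2 + k + nth 0 l (K + i)) < inp (2 + k + nth 0 l (K + j)))
           == (inp (2 + nth 0 l i) < inp (2 + nth 0 l j))))
        (iota 0 K)) (iota 0 K)].

Definition move (l : seq nat) i x y := set_nth 0 (set_nth 0 l i x) (K + i) y.

(** A nonzero entry of [T] marks a refuted word. Answers [y] up to [N] are tried; those not less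
    than [n] give invalid words, which are refuted in turn. *)
Definition refuted (T : nat -> nat) (l : seq nat) : bool :=
  ~~ valid l ||
  has (fun i => has (fun x => (x < k) &&
    all (fun y => T (enc N (move l i x y)) != 0) (iota 0 N)) (iota 0 N)) (iota 0 K).

Definition refute (T : nat -> nat) (l : seq nat) : nat -> nat :=
  if refuted T l then update T (enc N l) 1 else T.

Definition sweep (T : nat -> nat) := foldl refute T (words N (K + K)).

(** The words serve as a counter for the sweeps, matching a nest of loops in the program. *)
Definition consistency_table : nat -> nat :=
  foldl (fun T _ => sweep T) (fun=> 0) (words N (K + K)).

Definition leT (T T' : nat -> nat) := forall a, T a != 0 -> T' a != 0.

Lemma leT_trans T1 T2 T3 : leT T1 T2 -> leT T2 T3 -> leT T1 T3.
Proof. by move=> le12 le23 a /le12/le23. Qed.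

Lemma refuted_mono T T' l : leT T T' -> refuted T l -> refuted T' l.
Proof.
move=> le_T; rewrite /refuted; case: (valid l) => //=.
case/hasP=> i iK /hasP[x xN /andP[xk /allP ally]]; apply/hasP; exists i => //.
apply/hasP; exists x; rewrite // xk; apply/allP=> y yN.
exact/le_T/ally.
Qed.

Lemma refute_ge T l : leT T (refute T l).
Proof. by move=> a; rewrite /refute; case: ifP => // _; rewrite /update; case: (a == _). Qed.

Lemma foldl_refute_ge T s : leT T (foldl refute T s).
Proof.
elim: s T => [T a //|l s IHs T] /=; apply: leT_trans (IHs _); apply: refute_ge.
Qed.

Lemma foldl_refute_refuted T s l : l \in s -> refuted T l ->
  foldl refute T s (enc N l) != 0.
Proof.
elim: s T => // l' s IHs T; rewrite inE => /predU1P[<-|ls] ref_l /=.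
  by apply: foldl_refute_ge; rewrite /refute ref_l /update eqxx.
by apply: IHs => //; apply: refuted_mono ref_l; apply: refute_ge.
Qed.

Definition stable (T : nat -> nat) :=
  forall l, l \in words N (K + K) -> refuted T l -> T (enc N l) != 0.

Lemma sweep_stable T : stable T -> stable (sweep T).
Proof.
move=> st; suff ge : leT (sweep T) T.
  by move=> l lw ref_l; apply: foldl_refute_ge; apply: st => //; apply: refuted_mono ref_l.
rewrite /sweep; have: {subset words N (K + K) <= words N (K + K)} by [].
elim: {1 3}(words N (K + K)) T st => [T st _ a //|l s IHs T st sub] /=.
have ge : leT (refute T l) T.
  rewrite /refute; case: ifP => [ref_l a|_ a //]; rewrite /update.
  have [-> _|//] := eqVneq a (enc N l).
  by apply: st => //; apply: sub; rewrite inE eqxx.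
have st' : stable (refute T l).
  by move=> l' lw ref_l; apply: refute_ge; apply: st => //; apply: refuted_mono ref_l.
have sub' : {subset s <= words N (K + K)}.
  by move=> l' ls; apply: sub; rewrite inE ls orbT.
by move=> a /(IHs _ st' sub')/ge.
Qed.

(** A sweep of an unstable table marks at least one new word, so after as many sweeps as words the
    table is stable or everything is marked, which is stable too. *)
Lemma consistency_table_stable : stable consistency_table.
Proof.
pose dead T := count (fun l => T (enc N l) != 0) (words N (K + K)).
suff grow s : stable (foldl (fun T (_ : seq nat) => sweep T) (fun=> 0) s) \/
    size s <= dead (foldl (fun T (_ : seq nat) => sweep T) (fun=> 0) s).
  have [//|] := grow (words N (K + K)); rewrite -/consistency_table => full.
  have: all (fun l => consistency_table (enc N l) != 0) (words N (K + K)).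
    by rewrite all_count eqn_leq count_size full.
  by move/allP=> full' l /full'.
elim/last_ind: s => [|s w [st|le]]; first by right.
  by left; rewrite foldl_rcons; apply: sweep_stable.
rewrite foldl_rcons size_rcons; set T := foldl _ _ _ in le *.
have [bad|good] := boolP (has (fun l => refuted T l && (T (enc N l) == 0)) (words N (K + K))).
  right; apply: leq_ltn_trans le _; case/hasP: bad => l lw /andP[ref_l Tl0].
  have split_count P : count P (words N (K + K)) =
      P l + count P (rem l (words N (K + K))).
    by have /seq.permP -> := perm_to_rem lw.
  rewrite /dead !split_count Tl0 /= add0n (foldl_refute_refuted lw ref_l) add1n ltnS.
  by apply: sub_count => l'; apply: foldl_refute_ge.
left; apply: sweep_stable => l lw ref_l; apply: contra good => Tl0.
by apply/hasP; exists l; rewrite // ref_l.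
Qed.

Lemma consistency_table0 : 0 < N -> consistency_table 0 = 0.
Proof.
move=> N_gt0; have sweep0 T : T 0 = 0 -> sweep T 0 = 0.
  rewrite /sweep; elim: (words N (K + K)) T => //= l s IHs T T0; apply: IHs.
  rewrite /refute; case: ifP => // _; rewrite /update ifF //.
  by have := enc_gt0 l N_gt0; lia.
suff fold0 s T : T 0 = 0 -> foldl (fun T (_ : seq nat) => sweep T) T s 0 = 0 by apply: fold0.
by elim: s T => //= w s IHs T T0; apply/IHs/sweep0.
Qed.

Section Correctness.

Variables (pi : 'S_k) (tau : 'S_n).
Hypothesis k_gt0 : 0 < k.
Hypothesis inp_pi : forall x : 'I_k, inp (2 + x) = pi x.
Hypothesis inp_tau : forall y : 'I_n, inp (2 + k + y) = tau y.

Definition pebble_word (q : pebbling k n K) : seq nat :=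
  [seq nat_of_ord (q i).1 | i : 'I_K <- enum 'I_K] ++
  [seq nat_of_ord (q i).2 | i : 'I_K <- enum 'I_K].

Lemma size_pebble_word q : size (pebble_word q) = K + K.
Proof. by rewrite size_cat size_map size_map size_enum_ord. Qed.

Lemma nth_pebble_word1 q (i : 'I_K) : nth 0 (pebble_word q) i = (q i).1.
Proof.
rewrite nth_cat size_map size_enum_ord ltn_ord.
by rewrite (nth_map i) ?size_enum_ord // nth_ord_enum.
Qed.

Lemma nth_pebble_word2 q (i : 'I_K) : nth 0 (pebble_word q) (K + i) = (q i).2.
Proof.
rewrite nth_cat size_map size_enum_ord ltnNge leq_addr /= addKn.
by rewrite (nth_map i) ?size_enum_ord // nth_ord_enum.
Qed.

Lemma eq_double_word (l l' : seq nat) : size l = K + K -> size l' = K + K ->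
  (forall i : 'I_K, nth 0 l i = nth 0 l' i) ->
  (forall i : 'I_K, nth 0 l (K + i) = nth 0 l' (K + i)) -> l = l'.
Proof.
move=> sz sz' e1 e2; apply: (@eq_from_nth _ 0) => [|i]; rewrite sz ?sz' // => lt_i.
have [lt|ge] := ltnP i K; first exact: (e1 (Ordinal lt)).
have lt : i - K < K by lia.
by have := e2 (Ordinal lt); rewrite /= subnKC.
Qed.

Lemma size_move l i x y : size l = K + K -> i < K -> size (move l i x y) = K + K.
Proof. by move=> sz lt_i; rewrite !size_set_nth sz; lia. Qed.

Lemma move_words l i x y : l \in words N (K + K) -> i < K -> x < N -> y < N ->
  move l i x y \in words N (K + K).
Proof.
rewrite !mem_words => /andP[/eqP sz /(all_nthP 0) lt_l] lt_i lt_x lt_y.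
rewrite size_move // eqxx; apply/(all_nthP 0) => j; rewrite size_move // => lt_j.
rewrite /move nth_set_nth /=; case: (j == K + i) => //.
rewrite nth_set_nth /=; case: (j == i) => //.
by apply: lt_l; rewrite sz.
Qed.

Lemma move_pebble_word q (i : 'I_K) (x : 'I_k) (y : 'I_n) :
  move (pebble_word q) i x y = pebble_word (move_pebble q i x y).
Proof.
apply: eq_double_word; rewrite ?size_move ?size_pebble_word // => j.
- rewrite nth_pebble_word1 /move nth_set_nth /= nth_set_nth /= ffunE -val_eqE /=.
  case: (eqVneq (nat_of_ord j) (K + i)) => [e|_]; first by have := ltn_ord j; lia.
  by case: eqP => // _; rewrite nth_pebble_word1.
- rewrite nth_pebble_word2 /move nth_set_nth /= nth_set_nth /= ffunE -val_eqE /= eqn_add2l.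
  case: eqP => // _; case: (eqVneq (K + j) i) => [e|_]; last exact: nth_pebble_word2.
  by have := ltn_ord i; lia.
Qed.

Lemma pebble_word_words q : pebble_word q \in words N (K + K).
Proof.
rewrite mem_words size_pebble_word eqxx all_cat /=; apply/andP; split; apply/allP=> d /mapP[i _ ->].
  by have := ltn_ord (q i).1; lia.
by have := ltn_ord (q i).2; lia.
Qed.

Lemma valid_pebble_word (q : pebbling k n K) : reflect
  (forall i j, order_compatible pi tau (q i).1 (q j).1 (q i).2 (q j).2)
  (valid (pebble_word q)).
Proof.
apply: (iffP and3P) => [[_ _ /allP cmp] i j|cmp].
  have := cmp i; rewrite mem_iota ltn_ord => /(_ isT)/allP/(_ j).
  rewrite mem_iota ltn_ord => /(_ isT).
  rewrite !nth_pebble_word1 !nth_pebble_word2 !inp_pi !inp_tau.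
  by case/andP=> /eqP e1 /eqP e2; split.
have ordK (P : pred nat) : (forall i : 'I_K, P (nat_of_ord i)) -> all P (iota 0 K).
  by move=> PK; apply/allP=> i; rewrite mem_iota /= add0n => lt_i; apply: (PK (Ordinal lt_i)).
split; first by apply: ordK => i; rewrite nth_pebble_word1.
  by apply: ordK => i; rewrite nth_pebble_word2.
apply: (ordK) => i; apply: (ordK) => j.
rewrite !nth_pebble_word1 !nth_pebble_word2 !inp_pi !inp_tau.
by have [-> ->] := cmp i j; rewrite !eqxx.
Qed.

Lemma valid_pebble_wordE l : l \in words N (K + K) -> valid l ->
  exists q, l = pebble_word q.
Proof.
rewrite mem_words => /andP[/eqP sz _] /and3P[/allP lt1 /allP lt2 _].
have iK (i : 'I_K) : nat_of_ord i \in iota 0 K by rewrite mem_iota /=.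
exists [ffun i => (Ordinal (lt1 _ (iK i)), Ordinal (lt2 _ (iK i)))].
apply: eq_double_word; rewrite ?size_pebble_word // => i.
- by rewrite nth_pebble_word1 ffunE.
- by rewrite nth_pebble_word2 ffunE.
Qed.

(** Pebblings on the graph of [f] are valid, and any move to [x] is answered inside this family by
    [f x]; so none of them is ever the first to be refuted. *)
Lemma embedding_survives (f : 'I_k -> 'I_n) :
  (forall x y, order_compatible pi tau x y (f x) (f y)) ->
  forall q : pebbling k n K, (forall i, (q i).2 = f (q i).1) ->
  consistency_table (enc N (pebble_word q)) = 0.
Proof.
move=> cmp; pose good T := forall q : pebbling k n K, (forall i, (q i).2 = f (q i).1) ->
  T (enc N (pebble_word q)) = 0.
have good_refute T l : l \in words N (K + K) -> good T -> good (refute T l).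
  move=> lw gT q qf; rewrite /refute; case: ifP => [ref_l|_]; last exact: gT.
  rewrite /update; case: eqP => [/enc_inj e|_]; last exact: gT.
  have {}e := e _ (pebble_word_words q) lw; move: ref_l; rewrite -e /refuted.
  have -> /= : valid (pebble_word q).
    by apply/valid_pebble_word => i j; rewrite !qf; apply: cmp.
  case/hasP=> i; rewrite mem_iota /= add0n => lt_i /hasP[x _ /andP[lt_x /allP]].
  move/(_ (f (Ordinal lt_x))); rewrite mem_iota /= add0n.
  have -> : f (Ordinal lt_x) < N by have := ltn_ord (f (Ordinal lt_x)); lia.
  rewrite (move_pebble_word q (Ordinal lt_i) (Ordinal lt_x) (f (Ordinal lt_x))) => /(_ isT).
  by rewrite gT // => j; rewrite ffunE; case: eqP.
have good_sweep T : good T -> good (sweep T).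
  rewrite /sweep; have: {subset words N (K + K) <= words N (K + K)} by [].
  elim: {1 3}(words N (K + K)) T => //= l s IHs T sub gT; apply: IHs.
    by move=> l' ls; apply: sub; rewrite inE ls orbT.
  by apply: good_refute => //; apply: sub; rewrite inE eqxx.
rewrite /consistency_table; have: good (fun=> 0) by [].
by elim: (words N (K + K)) (fun=> 0) => //= w s IHs T gT; apply: IHs; apply: good_sweep.
Qed.

Lemma consistency_correct (B : nat -> {set 'I_k}) : path_decomposition pi K B ->
  has (fun l => consistency_table (enc N l) == 0) (words N (K + K)) <-> contains tau pi.
Proof.
move=> dec; split=> [/hasP[l lw alive_l]|[f [f_mono f_tau]]].
  pose A (q : pebbling k n K) := consistency_table (enc N (pebble_word q)) = 0.
  have A_refuted q : A q -> ~~ refuted consistency_table (pebble_word q).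
    move=> Aq; apply/negP=> /(consistency_table_stable (pebble_word_words q)).
    by rewrite Aq.
  apply: (@pebbles_contains k n K pi tau A _ _ B dec).
  - move=> q /A_refuted; rewrite /refuted negb_or negbK => /andP[/valid_pebble_word vq _].
    exact: vq.
  - move=> q i x Aq; have := A_refuted q Aq; rewrite /refuted negb_or => /andP[_].
    move/hasPn/(_ i); rewrite mem_iota ltn_ord => /(_ isT)/hasPn/(_ x).
    rewrite mem_iota.
    have -> : 0 <= x < 0 + N by have := ltn_ord x; lia.
    move=> /(_ isT); rewrite ltn_ord => /allPn[y]; rewrite mem_iota negbK => /andP[_ yN] /eqP alive_y.
    have mw : move (pebble_word q) i x y \in words N (K + K).
      by apply: move_words; rewrite ?pebble_word_words //; have := ltn_ord x; lia.
    (* The answer is only known to be below [N]; stability makes the unrefuted word valid, hence [y]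
       is a text position. *)
    have : valid (move (pebble_word q) i x y).
      apply: contraT => nv; have := consistency_table_stable mw.
      by rewrite /refuted nv alive_y => /(_ isT).
    case/and3P=> _ /allP/(_ i) + _; rewrite mem_iota ltn_ord => /(_ isT).
    rewrite /move nth_set_nth /= eqxx => lt_y; exists (Ordinal lt_y).
    by rewrite /A -move_pebble_word.
  - have [|q e] := @valid_pebble_wordE l lw; last by exists q; rewrite /A -e (eqP alive_l).
    apply: contraT => nv; have := consistency_table_stable lw.
    by rewrite /refuted nv alive_l => /(_ isT).
pose q : pebbling k n K := [ffun=> (Ordinal k_gt0, f (Ordinal k_gt0))].
apply/hasP; exists (pebble_word q); first exact: pebble_word_words.
rewrite (@embedding_survives f) // => [x y|i]; last by rewrite ffunE.
split=> //; have [lt|gt|/val_inj ->] := ltngtP x y; last by rewrite ltnn.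
  exact: f_mono.
by have := f_mono _ _ gt; lia.
Qed.

End Correctness.
End Consistency.

(** * Reasoning about machine programs *)

(** The input length 2 + k + n, recomputed from registers 0 and 1, which must therefore stay intact
    while addresses are computed. *)
Definition ESize : expr := Add (Const 2) (Add (Read (Const 0)) (Read (Const 1))).
Definition Addr (j : nat) : expr := Add (Const j) ESize.
Definition Var (j : nat) : expr := Read (Addr j).

(** Every loop runs over all of [0, N), the truncated difference vanishing exactly at the end.
    Narrower ranges are imposed by tests in the body. *)
Definition For (j : nat) (body : program) : program :=
  Seq (Write (Addr j) (Const 0))
      (While (Defs.Sub ESize (Var j))
             (Seq body (Write (Addr j) (Add (Var j) (Const 1))))).

Fixpoint nest (js : seq nat) (body : program) : program :=
  if js is j :: js' then For j (nest js' body) else body.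

(* Valid for programs whose [While] loops all come from [For]. *)
Fixpoint time_bound (N : nat) (P : program) : nat :=
  match P with
  | Skip => 1
  | Write a e => (expr_cost a + expr_cost e).+1
  | Seq P Q => time_bound N P + time_bound N Q
  | If e P Q => (expr_cost e + (time_bound N P + time_bound N Q)).+1
  | While e P => N.+1 * (expr_cost e + time_bound N P).+1
  end.

Fixpoint time_poly (P : program) : {poly nat} :=
  match P with
  | Skip => 1%:P
  | Write a e => ((expr_cost a + expr_cost e).+1)%:P
  | Seq P Q => time_poly P + time_poly Q
  | If e P Q => (expr_cost e).+1%:P + (time_poly P + time_poly Q)
  | While e P => ('X + 1%:P) * ((expr_cost e).+1%:P + time_poly P)
  end%R.

Lemma horner_time_poly N P : (time_poly P).[N]%R = time_bound N P.
Proof.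
elim: P => //=.
- by rewrite hornerC.
- by move=> a e; rewrite hornerC.
- by move=> P IHP Q IHQ; rewrite hornerD IHP IHQ.
- by move=> e P IHP Q IHQ; rewrite !hornerD hornerC IHP IHQ.
- by move=> e P IHP; rewrite hornerM !hornerD hornerX !hornerC IHP; lia.
Qed.

Section Machine.

Variables (V k n : nat) (inp : memory).
Hypotheses (inp0 : inp 0 = k) (inp1 : inp 1 = n).
Let N := 2 + k + n.

Definition state : Type := (memory * memory)%type.

(** Three zones: the fixed input, [V] variables, and the unbounded table. *)
Definition ram (s : state) : memory :=
  fun a => if a < N then inp a else if a < N + V then s.1 (a - N) else s.2 (a - (N + V)).

(** Total correctness with a purely syntactic time bound, so that the proofs about concrete programs
    need no time accounting. *)
Definition wp (P : program) (s : state) (Q : state -> Prop) : Prop :=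
  exists t s', [/\ t <= time_bound N P, exec P (ram s) t (ram s') & Q s'].

Lemma eval_size s : eval (ram s) ESize = N.
Proof. by rewrite /= /ram /= inp0 inp1 /N addnA. Qed.

Lemma eval_var s j : j < V -> eval (ram s) (Var j) = s.1 j.
Proof.
move=> lt_j; rewrite /= /ram /= inp0 inp1.
have -> : (j + (2 + (k + n)) < N) = false by rewrite /N; lia.
by rewrite ifT; [congr (s.1 _) | ]; rewrite /N; lia.
Qed.

Definition TabAddr (e : expr) : expr := Add (Add (Const V) ESize) e.
Definition Tab (e : expr) : expr := Read (TabAddr e).

Lemma eval_tab s e : eval (ram s) (Tab e) = s.2 (eval (ram s) e).
Proof.
rewrite /=; set a := eval _ e; rewrite /ram /= inp0 inp1.
have -> : (V + (2 + (k + n)) + a < N) = false by rewrite /N; lia.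
by rewrite ifF; [congr (s.2 _) | ]; rewrite /N; lia.
Qed.

Lemma wp_mono P s (Q Q' : state -> Prop) : (forall s', Q s' -> Q' s') -> wp P s Q -> wp P s Q'.
Proof. by move=> sub [t [s' [le_t ex Qs]]]; exists t, s'; split=> //; apply: sub. Qed.

Lemma wp_skip s (Q : state -> Prop) : Q s -> wp Skip s Q.
Proof. by move=> Qs; exists 1, s; split=> //; constructor. Qed.

Lemma wp_seq P1 P2 s Q : wp P1 s (fun s1 => wp P2 s1 Q) -> wp (Seq P1 P2) s Q.
Proof.
move=> [t1 [s1 [le1 ex1 [t2 [s2 [le2 ex2 Qs]]]]]]; exists (t1 + t2), s2; split=> //.
  by rewrite leq_add.
exact: ExecSeq ex1 ex2.
Qed.

Lemma wp_if e P1 P2 s Q :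
  (eval (ram s) e != 0 -> wp P1 s Q) -> (eval (ram s) e = 0 -> wp P2 s Q) ->
  wp (If e P1 P2) s Q.
Proof.
move=> w1 w2; have [e0|ne0] := eqVneq (eval (ram s) e) 0.
  case: (w2 e0) => t [s' [le_t ex Qs]].
  exists (expr_cost e + t).+1, s'; split=> //=.
  by rewrite ltnS leq_add2l (leq_trans le_t) ?leq_addl.
  exact: ExecIfF.
case: (w1 ne0) => t [s' [le_t ex Qs]].
exists (expr_cost e + t).+1, s'; split=> //=.
  by rewrite ltnS leq_add2l (leq_trans le_t) ?leq_addr.
exact: ExecIfT.
Qed.

Lemma update_mem_var s j x : j < V ->
  update (ram s) (j + N) x = ram (update s.1 j x, s.2).
Proof.
move=> lt_j; apply: functional_extensionality => a; rewrite /update /ram /=.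
case: eqP => [->|ne].
  rewrite ifF; last by lia.
  by rewrite ifT ?addnK ?eqxx //; lia.
case: ltnP => // le_a; case: ltnP => // lt_a.
by rewrite ifF //; lia.
Qed.

Lemma update_mem_tab s a x :
  update (ram s) (V + N + a) x = ram (s.1, update s.2 a x).
Proof.
apply: functional_extensionality => b; rewrite /update /ram /=.
case: eqP => [->|ne].
  rewrite ifF; last by lia.
  rewrite ifF; last by lia.
  by rewrite ifT //; lia.
case: ltnP => // le_a; case: ltnP => // lt_a.
by rewrite ifF //; lia.
Qed.

Lemma wp_set j e s (Q : state -> Prop) : j < V ->
  Q (update s.1 j (eval (ram s) e), s.2) -> wp (Write (Addr j) e) s Q.
Proof.
move=> lt_j Qs; exists (time_bound N (Write (Addr j) e)), (update s.1 j (eval (ram s) e), s.2).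
split=> //; rewrite -update_mem_var // -(eval_size s); exact: ExecWrite.
Qed.

Lemma wp_set_tab a e s (Q : state -> Prop) :
  Q (s.1, update s.2 (eval (ram s) a) (eval (ram s) e)) -> wp (Write (TabAddr a) e) s Q.
Proof.
move=> Qs; exists (time_bound N (Write (TabAddr a) e)),
  (s.1, update s.2 (eval (ram s) a) (eval (ram s) e)).
split=> //; rewrite -update_mem_tab -(eval_size s); exact: ExecWrite.
Qed.

Lemma wp_for j body s (Inv : nat -> state -> Prop) (Q : state -> Prop) :
  j < V -> Inv 0 (update s.1 j 0, s.2) ->
  (forall i s, i < N -> Inv i s -> s.1 j = i ->
     wp body s (fun s' => s'.1 j = i /\ Inv i.+1 (update s'.1 j i.+1, s'.2))) ->
  (forall s', Inv N s' -> Q s') ->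
  wp (For j body) s Q.
Proof.
move=> lt_j Inv0 step InvQ; apply: wp_seq; apply: wp_set => //=.
set s0 := (update _ _ _, _) in Inv0 *.
set W := While _ _; pose test := (expr_cost (Defs.Sub ESize (Var j)) +
  time_bound N (Seq body (Write (Addr j) (Add (Var j) (Const 1))))).+1.
suff loop d i s1 : i + d = N -> Inv i s1 -> s1.1 j = i ->
    exists t s', [/\ t <= d.+1 * test, exec W (ram s1) t (ram s') & Inv N s'].
  have [|t [s' [le_t ex IN]]] := loop N 0 s0 (add0n _) Inv0.
    by rewrite /s0 /update /= eqxx.
  by exists t, s'; split=> //; apply: InvQ.
elim: d i s1 => [|d IHd] i s1 id Is1 s1j.
  exists (expr_cost (Defs.Sub ESize (Var j))).+1, s1; split.
  - by rewrite mul1n /test; lia.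
  - apply: ExecWhileF; rewrite [eval _ _]/= -/(eval _ ESize).
    have := eval_size s1; have := eval_var s1 lt_j; rewrite /= => -> ->; lia.
  - by rewrite -id addn0.
have [|t1 [s2 [le_t1 ex1 [s2j Is2]]]] := step i s1 _ Is1 s1j; first by lia.
have [|||t2 [s3 [le_t2 ex2 IN]]] := IHd i.+1 (update s2.1 j i.+1, s2.2) => //.
- by lia.
- by rewrite /update /= eqxx.
pose incr := (expr_cost (Addr j) + expr_cost (Add (Var j) (Const 1))).+1.
exists (expr_cost (Defs.Sub ESize (Var j)) + (t1 + incr) + t2).+1, s3; split=> //.
- have le_body : t1 + incr <=
      time_bound N (Seq body (Write (Addr j) (Add (Var j) (Const 1)))).
    by rewrite leq_add2r.
  by rewrite mulSn /test; lia.
apply: ExecWhileT ex2.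
  have := eval_size s1; have := eval_var s1 lt_j; rewrite /= => -> ->; lia.
apply: ExecSeq ex1 _; rewrite -update_mem_var // -(eval_size s2).
have -> : i.+1 = eval (ram s2) (Add (Var j) (Const 1)).
  by have := eval_var s2 lt_j; rewrite /= => ->; lia.
exact: ExecWrite.
Qed.

(** [D] holds the counters of the enclosing loops, already fixed, [L] those still to be opened, and
    [U] the variables that the body may overwrite. Nested loops meet the words in the order of
    [words]. *)
Lemma wp_nest (U : pred nat) (F : seq nat -> memory -> memory) body D L :
  (forall v T, (forall j, j \in D ++ L -> v j < N) -> wp body (v, T) (fun s' =>
     s'.2 = F [seq v j | j <- D ++ L] T /\ forall j, ~~ U j -> s'.1 j = v j)) ->
  uniq (D ++ L) -> (forall j, j \in D ++ L -> ~~ U j /\ j < V) ->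
  forall v T, (forall j, j \in D -> v j < N) -> wp (nest L body) (v, T) (fun s' =>
    s'.2 = foldl (fun T w => F ([seq v j | j <- D] ++ w) T) T (words N (size L)) /\
    forall j, ~~ U j -> j \notin L -> s'.1 j = v j).
Proof.
elim: L D => [|j L IHL] D.
  rewrite cats0 => spec _ _ v T ltv; apply: wp_mono (spec v T ltv) => s' [-> fr].
  by split=> [|j Uj _]; [rewrite /= cats0 | apply: fr].
rewrite -cat_rcons => spec uniq_DL ok v T ltv.
have [Uj lt_j] : ~~ U j /\ j < V by apply: ok; rewrite mem_cat mem_rcons inE eqxx.
have [jL jD] : j \notin L /\ j \notin D.
  move: uniq_DL; rewrite cat_uniq rcons_uniq => /and3P[/andP[jD _] dis _]; split=> //.
  by apply: contra dis => jL; apply/hasP; exists j; rewrite // mem_rcons inE eqxx.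
(* The words treated before round [i]: those with first letter below [i]. *)
pose W i := flatten [seq [seq x :: w | w <- words N (size L)] | x <- iota 0 i].
pose G T w := F ([seq v j | j <- D] ++ w) T.
apply: (wp_for (Inv := fun i s => s.2 = foldl G T (W i) /\
    forall j', ~~ U j' -> j' \notin j :: L -> s.1 j' = v j')) => //.
- split=> // j' _; rewrite inE negb_or /update /= => /andP[/negPf -> //].
- move=> i [v1 T1] /= lt_i [T1E fr] v1j.
  have v1D : [seq v1 j | j <- rcons D j] = rcons [seq v j | j <- D] i.
    rewrite map_rcons v1j; congr rcons; apply/eq_in_map => j' j'D.
    have [Uj' _] : ~~ U j' /\ j' < V by apply: ok; rewrite mem_cat mem_rcons inE j'D orbT.
    apply: fr => //; rewrite inE negb_or; apply/andP; split.
      by apply: contraNneq jD => <-.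
    move: uniq_DL; rewrite cat_uniq => /and3P[_ /hasPn dis _].
    by apply/negP=> /dis; rewrite mem_rcons inE j'D orbT.
  apply: wp_mono (IHL (rcons D j) spec uniq_DL ok v1 T1 _) => [[v2 T2] /= [T2E fr2]|j'].
    split; first by rewrite fr2.
    split.
      rewrite T2E T1E /W -addn1 iotaD map_cat flatten_cat foldl_cat /= cats0 v1D add0n.
      elim: (words N (size L)) (foldl G T _) => //= w s IHs T'.
      by rewrite IHs /G cat_rcons.
    move=> j' Uj'; rewrite inE negb_or => /andP[ne j'L]; rewrite /update (negPf ne) fr2 //.
    by apply: fr; rewrite // inE negb_or ne.
  rewrite mem_rcons inE => /predU1P[->|j'D]; first by rewrite v1j.
  have : v1 j' \in [seq v1 j | j <- rcons D j] by apply: map_f; rewrite mem_rcons inE j'D orbT.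
  by rewrite v1D mem_rcons inE => /predU1P[-> //|/mapP[j2 j2D ->]]; apply: ltv.
Qed.

End Machine.

(** * The matching program *)

(* Variables [0, 2K) hold the current word, [2K, 4K) count the sweeps, and the
   remaining seven are scratch. Cell [0] of the table, which encodes no word,
   receives the answer. *)
Local Notation vX K := (4 * K).
Local Notation vY K := (4 * K + 1).
Local Notation vAcc K := (4 * K + 2).
Local Notation vTmp K := (4 * K + 3).
Local Notation vJ K := (4 * K + 4).
Local Notation vAlive K := (4 * K + 5).
Local Notation vFlag K := (4 * K + 6).
Local Notation nvars K := (4 * K + 7).

(** Horner's rule; the machine cannot multiply, so the product with N is a loop of N additions. *)
Fixpoint EncodeFrom (K : nat) (js : seq nat) : program :=
  if js is j :: js' then
    Seq (Write (Addr (vTmp K)) (Const 0))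
    (Seq (For (vJ K) (Write (Addr (vTmp K)) (Add (Var (vTmp K)) (Var (vAcc K)))))
    (Seq (Write (Addr (vAcc K)) (Add (Var (vTmp K)) (Var j)))
         (EncodeFrom K js')))
  else Skip.

Definition Encode (K : nat) (js : seq nat) : program :=
  Seq (Write (Addr (vAcc K)) (Const 1)) (EncodeFrom K js).

Definition ELt (a b : expr) : expr :=
  Defs.Sub (Const 1) (Defs.Sub (Const 1) (Defs.Sub b a)).
Definition ENeq (a b : expr) : expr := Add (Defs.Sub a b) (Defs.Sub b a).
Definition ESum (es : seq expr) : expr := foldr Add (Const 0) es.

Definition EPi (i : nat) : expr := Read (Add (Const 2) (Var i)).
Definition ETau (j : nat) : expr := Read (Add (Add (Const 2) (Read (Const 0))) (Var j)).

(** A sum of violations, zero exactly on valid words. Out-of-range letters may make the last sum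
    read unrelated registers, but then one of the first two sums is already positive. *)
Definition EInvalid (K : nat) : expr :=
  ESum [:: ESum [seq Defs.Sub (Add (Const 1) (Var i)) (Read (Const 0)) | i <- iota 0 K];
           ESum [seq Defs.Sub (Add (Const 1) (Var (K + i))) (Read (Const 1)) | i <- iota 0 K];
           ESum [seq ESum [seq Add (ENeq (ELt (Var (K + i)) (Var (K + j))) (ELt (Var i) (Var j)))
                                   (ENeq (ELt (ETau (K + i)) (ETau (K + j))) (ELt (EPi i) (EPi j)))
                          | j <- iota 0 K] | i <- iota 0 K]].

(** [move] acts here on the list of variable numbers: the encoder reads [vX] and [vY] in place of
    pebble [i], and the stored word is not touched. *)
Definition TryMove (K i : nat) : program :=
  For (vX K)
   (Seq (Write (Addr (vAlive K)) (Const 0))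
   (Seq (For (vY K)
          (Seq (Encode K (move K (iota 0 (K + K)) i (vX K) (vY K)))
               (If (Tab (nvars K) (Var (vAcc K))) Skip (Write (Addr (vAlive K)) (Const 1)))))
        (If (Defs.Sub (Read (Const 0)) (Var (vX K)))
            (If (Var (vAlive K)) Skip (Write (Addr (vFlag K)) (Const 1)))
            Skip))).

Definition Refute (K : nat) : program :=
  Seq (Write (Addr (vFlag K)) (EInvalid K))
  (Seq (foldr (fun i P => Seq (TryMove K i) P) Skip (iota 0 K))
  (Seq (Encode K (iota 0 (K + K)))
       (If (Var (vFlag K)) (Write (TabAddr (nvars K) (Var (vAcc K))) (Const 1)) Skip))).

Definition Report (K : nat) : program :=
  Seq (Encode K (iota 0 (K + K)))
      (If (Tab (nvars K) (Var (vAcc K))) Skip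
          (Write (TabAddr (nvars K) (Const 0)) (Const 1))).

(** Register 0 holds k and enters every address, so the answer is copied there only at the end. The
    other branch accepts the empty pattern. *)
Definition Matching (K : nat) : program :=
  If (Read (Const 0))
     (Seq (nest (iota (K + K) (K + K)) (nest (iota 0 (K + K)) (Refute K)))
     (Seq (nest (iota 0 (K + K)) (Report K))
          (Write (Const 0) (Tab (nvars K) (Const 0)))))
     (Write (Const 0) (Const 1)).

#[local] Arguments eval m e : simpl never.

Lemma eval_const m c : eval m (Const c) = c. Proof. by []. Qed.
Lemma eval_add m a b : eval m (Add a b) = eval m a + eval m b. Proof. by []. Qed.
Lemma eval_sub m a b : eval m (Defs.Sub a b) = eval m a - eval m b. Proof. by []. Qed.
Lemma eval_read m a : eval m (Read a) = m (eval m a). Proof. by []. Qed.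

Lemma eval_lt m a b : eval m (ELt a b) = (eval m a < eval m b).
Proof. by rewrite !eval_sub !eval_const; lia. Qed.

Lemma eval_neq m a b : (eval m (ENeq a b) == 0) = (eval m a == eval m b).
Proof. by rewrite eval_add !eval_sub; lia. Qed.

Lemma eval_sum m es : (eval m (ESum es) == 0) = all (fun e => eval m e == 0) es.
Proof. by elim: es => //= e es <-; rewrite eval_add addn_eq0. Qed.

Lemma update_eq m a x : update m a x a = x.
Proof. by rewrite /update eqxx. Qed.

Lemma update_neq m a b x : b != a -> update m a x b = m b.
Proof. by rewrite /update => /negPf ->. Qed.

Ltac simpl_update :=
  repeat match goal with
  | |- context [update ?m ?a ?x ?a] => rewrite (update_eq m a x)
  | |- context [update ?m ?a ?x ?b] => rewrite (@update_neq m a b x ltac:(lia))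
  end.

Lemma map_set_nth (f : nat -> nat) s i x :
  i < size s -> map f (set_nth 0 s i x) = set_nth 0 (map f s) i (f x).
Proof. by elim: s i => // y s IHs [|i] //= lt_i; rewrite IHs. Qed.

Section Programs.

Variables (K k n : nat) (inp : memory).
Hypotheses (inp0 : inp 0 = k) (inp1 : inp 1 = n).
Let N := 2 + k + n.
Local Notation wpK := (wp (nvars K) k n inp).
Local Notation ramK := (ram (nvars K) k n inp).
Local Notation enc_scratch j := (vAcc K <= j <= vJ K).

Let eval_v (s : state) j : j < nvars K -> eval (ramK s) (Var j) = s.1 j.
Proof. exact: eval_var. Qed.

Let wp_setK := @wp_set (nvars K) k n inp inp0 inp1.
Let wp_set_tabK := @wp_set_tab (nvars K) k n inp inp0 inp1.

Lemma wp_encode_from js v T :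
  (forall j, j \in js -> j < nvars K /\ ~~ enc_scratch j) ->
  wpK (EncodeFrom K js) (v, T) (fun s' =>
    [/\ s'.2 = T, s'.1 (vAcc K) = foldl (fun a d => a * N + d) (v (vAcc K)) [seq v j | j <- js]
      & forall j, ~~ enc_scratch j -> s'.1 j = v j]).
Proof.
elim: js v => [|j js IHjs] v ok; first by apply: wp_skip.
have [lt_j sc_j] := ok j (mem_head _ _).
apply: wp_seq; apply: wp_setK => /=; first by lia.
apply: wp_seq; apply: (wp_for inp0 inp1 (Inv := fun i s => [/\ s.2 = T,
    s.1 (vTmp K) = v (vAcc K) * i, s.1 (vAcc K) = v (vAcc K)
    & forall j, ~~ enc_scratch j -> s.1 j = v j])) => //.
- by lia.
- split=> //=; simpl_update; rewrite ?muln0 //.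
  by move=> j' sc; simpl_update.
- move=> i [v1 T1] lt_i /= [-> tmpE accE fr] v1J.
  apply: wp_setK => /=; first by lia.
  rewrite eval_add !eval_v; try lia; rewrite /=; split; first by simpl_update.
  split=> //; simpl_update => //; first by rewrite tmpE accE mulnS addnC.
  by move=> j' sc; simpl_update; apply: fr.
move=> [v1 T1] /= [-> tmpE accE fr].
apply: wp_seq; apply: wp_setK => /=; first by lia.
rewrite eval_add !eval_v; try lia; rewrite /= tmpE fr //.
set v2 := update _ _ _.
have v2E j' : ~~ enc_scratch j' -> v2 j' = v j'.
  by move=> sc; rewrite /v2; simpl_update; apply: fr.
apply: wp_mono (IHjs v2 _) => [[v3 T3] /= [-> -> fr3]|j' j'js]; last first.
  by apply: ok; rewrite inE j'js orbT.
split=> //; last by move=> j' sc; rewrite fr3 ?v2E.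
rewrite {1}/v2 update_eq; congr foldl; apply/eq_in_map => j' j'js; apply: v2E.
by have [] := ok j'; rewrite // inE j'js orbT.
Qed.

Lemma wp_encode js v T :
  (forall j, j \in js -> j < nvars K /\ ~~ enc_scratch j) ->
  wpK (Encode K js) (v, T) (fun s' =>
    [/\ s'.2 = T, s'.1 (vAcc K) = enc N [seq v j | j <- js]
      & forall j, ~~ enc_scratch j -> s'.1 j = v j]).
Proof.
move=> ok; apply: wp_seq; apply: wp_setK => /=; first by lia.
apply: wp_mono (wp_encode_from _ _ ok) => [[v1 T1] /= [-> -> fr]]; split=> //.
  rewrite update_eq /enc; congr foldl; apply/eq_in_map => j /ok[_ sc].
  by simpl_update.
by move=> j sc; rewrite fr //; simpl_update.
Qed.

Lemma eval_invalid v T :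
  (eval (ramK (v, T)) (EInvalid K) != 0) = ~~ valid k n K inp [seq v j | j <- iota 0 (K + K)].
Proof.
set l := map _ _.
have nth_l j : j < K + K -> nth 0 l j = v j.
  by move=> lt_j; rewrite (nth_map 0) ?size_iota // nth_iota.
have ev0 : eval (ramK (v, T)) (Read (Const 0)) = k by rewrite eval_read /ram.
have ev1 : eval (ramK (v, T)) (Read (Const 1)) = n by rewrite eval_read /ram.
congr (~~ _); rewrite eval_sum [all _ _]/= andbT !eval_sum !all_map /valid.
have e1 : all (preim (fun i => Defs.Sub (Add (Const 1) (Var i)) (Read (Const 0)))
    (fun e => eval (ramK (v, T)) e == 0)) (iota 0 K) = all (fun i => nth 0 l i < k) (iota 0 K).
  apply: eq_in_all => i; rewrite mem_iota => lt_i.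
  by rewrite /= eval_sub eval_add ev0 eval_v ?nth_l ?eval_const /=; lia.
have e2 : all (preim (fun i => Defs.Sub (Add (Const 1) (Var (K + i))) (Read (Const 1)))
    (fun e => eval (ramK (v, T)) e == 0)) (iota 0 K) = all (fun i => nth 0 l (K + i) < n) (iota 0 K).
  apply: eq_in_all => i; rewrite mem_iota => lt_i.
  by rewrite /= eval_sub eval_add ev1 eval_v ?nth_l ?eval_const /=; lia.
rewrite e1 e2; have [/allP lt1|//] := boolP (all (fun i => nth 0 l i < k) _).
have [/allP lt2|//] := boolP (all (fun i => nth 0 l (K + i) < n) _).
have evPi i : i \in iota 0 K -> eval (ramK (v, T)) (EPi i) = inp (2 + nth 0 l i).
  move=> iK; have lt := lt1 i iK; move: iK; rewrite mem_iota => lt_i.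
  have lt_i2 : i < K + K by lia.
  rewrite nth_l // in lt *; rewrite eval_read eval_add eval_const eval_v; last by lia.
  by rewrite /ram /= ifT //; lia.
have evTau i : i \in iota 0 K -> eval (ramK (v, T)) (ETau (K + i)) = inp (2 + k + nth 0 l (K + i)).
  move=> iK; have lt := lt2 i iK; move: iK; rewrite mem_iota => lt_i.
  have lt_i2 : K + i < K + K by lia.
  rewrite nth_l // in lt *; rewrite eval_read !eval_add eval_const ev0 eval_v; last by lia.
  by rewrite /ram /= ifT //; lia.
apply: eq_in_all => i iK; rewrite [LHS]/= eval_sum all_map.
apply: eq_in_all => j jK; rewrite [LHS]/= eval_add addn_eq0.
rewrite !eval_neq !eval_lt !evPi // !evTau //.
move: iK jK; rewrite !mem_iota => iK jK.
by rewrite !eval_v ?nth_l /=; lia.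
Qed.

Let word (v : memory) := [seq v j | j <- iota 0 (K + K)].

Let eq_word v v' : (forall j, j < vX K -> v j = v' j) -> word v = word v'.
Proof.
by move=> e; apply/eq_in_map => j; rewrite mem_iota => lt_j; apply: e; lia.
Qed.

Let map_move v i : i < K ->
  [seq v j | j <- move K (iota 0 (K + K)) i (vX K) (vY K)] =
  move K (word v) i (v (vX K)) (v (vY K)).
Proof.
move=> lt_i; rewrite /move map_set_nth ?map_set_nth ?size_set_nth ?size_iota //; lia.
Qed.

Lemma wp_try_move i v T : i < K ->
  wpK (TryMove K i) (v, T) (fun s' =>
    [/\ s'.2 = T,
        (s'.1 (vFlag K) != 0) = (v (vFlag K) != 0) ||
          has (fun x => (x < k) &&
            all (fun y => T (enc N (move K (word v) i x y)) != 0) (iota 0 N)) (iota 0 N)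
      & forall j, j < vX K -> s'.1 j = v j]).
Proof.
(* [B x] says that a pattern position below [x] already refutes the word. *)
move=> lt_i; set P := fun x => _ && _; pose B x := has P (iota 0 x).
have BS x : B x.+1 = B x || P x by rewrite /B -addn1 iotaD has_cat /= orbF.
apply: (wp_for inp0 inp1 (Inv := fun x s => [/\ s.2 = T,
  (s.1 (vFlag K) != 0) = (v (vFlag K) != 0) || B x
  & forall j, j < vX K -> s.1 j = v j])) => //.
- by lia.
- by split=> [||j lt_j] //=; simpl_update; rewrite ?orbF.
move=> x [v1 T1] lt_x /= [-> flagE fr] v1X.
(* [C y] says that an answer below [y] is still unrefuted. *)
pose C y := has (fun y => T (enc N (move K (word v) i x y)) == 0) (iota 0 y).
have CS y : C y.+1 = C y || (T (enc N (move K (word v) i x y)) == 0).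
  by rewrite /C -addn1 iotaD has_cat /= orbF.
apply: wp_seq; apply: wp_setK => /=; first by lia.
apply: wp_seq; apply: (wp_for inp0 inp1 (Inv := fun y s => [/\ s.2 = T,
  (s.1 (vAlive K) != 0) = C y
  & forall j, (j <= vX K) || (j == vFlag K) -> s.1 j = v1 j])).
- by lia.
- split=> [||j lt_j] //=; simpl_update => //.
- move=> y [v2 T2] lt_y /= [-> aliveE fr2] v2Y.
  apply: wp_seq; apply: wp_mono (wp_encode _ _ _) => [[v3 T3] /= [-> accE fr3]|j]; last first.
    rewrite /move => /(nthP 0)[p]; rewrite !size_set_nth size_iota => lt_p <-.
    rewrite nth_set_nth /= nth_set_nth /=; case: (p == K + i); first by lia.
    case: (p == i); first by lia.
    by rewrite nth_iota; lia.
  have {}accE : v3 (vAcc K) = enc N (move K (word v) i x y).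
    rewrite accE map_move // v2Y fr2 ?leqnn // v1X; congr (enc _ (move _ _ _ _ _)).
    by apply: eq_word => j lt_j; rewrite fr2 ?fr //; lia.
  have aliveS : C y.+1 = (v3 (vAlive K) != 0) || (T (v3 (vAcc K)) == 0).
    by rewrite CS -aliveE accE fr3 //; lia.
  apply: wp_if; rewrite eval_tab // eval_v /=; try lia; move=> T3E.
    apply: wp_skip => /=; split; first by rewrite fr3 //; lia.
    split=> [||j lt_j] //; simpl_update.
      by rewrite aliveS (negPf T3E) orbF.
    by rewrite fr3 ?fr2 //; lia.
  apply: wp_setK => /=; first by lia.
  split; first by simpl_update; rewrite fr3 //; lia.
  split=> [||j lt_j] //; simpl_update.
    by rewrite aliveS T3E eqxx orbT.
  by rewrite fr3 ?fr2 //; lia.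
move=> [v2 T2] /= [-> aliveE fr2].
have flagS : (v (vFlag K) != 0) || B x.+1 =
    (v2 (vFlag K) != 0) || (x < k) && (v2 (vAlive K) == 0).
  rewrite BS orbA -flagE fr2 ?eqxx ?orbT //.
  congr (_ || _); rewrite /P; congr (_ && _).
  rewrite -[RHS]negbK aliveE -all_predC; exact: eq_all.
have v2X : v2 (vX K) = x by rewrite fr2 ?leqnn.
have fr' j : j < vX K -> v2 j = v j by move=> lt_j; rewrite fr2 ?fr //; lia.
have ev0 : eval (ramK (v2, T)) (Read (Const 0)) = k by rewrite eval_read /ram.
apply: wp_if; rewrite eval_sub ev0 eval_v /= ?v2X; try lia; move=> xk.
  apply: wp_if; rewrite eval_v /=; try lia; move=> alive2.
    apply: wp_skip; split=> //=; split=> [||j lt_j] //; simpl_update => //; last exact: fr'.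
    by rewrite flagS (negPf alive2) andbF orbF.
  apply: wp_setK => /=; first by lia.
  split; first by simpl_update.
  split=> [||j lt_j] //; simpl_update => //; last exact: fr'.
  by rewrite flagS alive2 eqxx (_ : x < k) ?orbT //; lia.
apply: wp_skip; split=> //=; split=> [||j lt_j] //; simpl_update => //; last exact: fr'.
by rewrite flagS (_ : x < k = false) ?orbF //; lia.
Qed.

Lemma wp_try_moves s v T : {subset s <= iota 0 K} ->
  wpK (foldr (fun i P => Seq (TryMove K i) P) Skip s) (v, T) (fun s' =>
    [/\ s'.2 = T,
        (s'.1 (vFlag K) != 0) = (v (vFlag K) != 0) ||
          has (fun i => has (fun x => (x < k) &&
            all (fun y => T (enc N (move K (word v) i x y)) != 0) (iota 0 N)) (iota 0 N)) s
      & forall j, j < vX K -> s'.1 j = v j]).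
Proof.
elim: s v => [|i s IHs] v sub; first by apply: wp_skip; split; rewrite ?orbF.
have := sub i (mem_head _ _); rewrite mem_iota => lt_i.
rewrite [foldr _ _ _]/=.
apply: wp_seq; apply: wp_mono (wp_try_move _ _ lt_i) => [[v1 T1] /= [-> flag1 fr1]].
have sub' : {subset s <= iota 0 K} by move=> j js; apply: sub; rewrite inE js orbT.
apply: wp_mono (IHs v1 sub') => [[v2 T2] /= [-> flag2 fr2]].
split=> //; last by move=> j lt_j; rewrite fr2 ?fr1.
by rewrite flag2 flag1 (eq_word fr1) -orbA.
Qed.

Lemma wp_encode_word v T : wpK (Encode K (iota 0 (K + K))) (v, T) (fun s' =>
    [/\ s'.2 = T, s'.1 (vAcc K) = enc N (word v) & forall j, ~~ enc_scratch j -> s'.1 j = v j]).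
Proof. by apply: wp_encode => j; rewrite mem_iota; lia. Qed.

Lemma wp_refute v T : wpK (Refute K) (v, T) (fun s' =>
  s'.2 = refute k n K N inp T (word v) /\ forall j, j < vX K -> s'.1 j = v j).
Proof.
apply: wp_seq; apply: wp_setK => /=; first by lia.
set v0 := update _ _ _.
have fr0 j : j < vX K -> v0 j = v j by move=> lt_j; rewrite /v0; simpl_update.
apply: wp_seq; apply: wp_mono (wp_try_moves _ _ _) => [[v1 T1] /= [-> flag1 fr1]|//].
apply: wp_seq; apply: wp_mono (wp_encode_word _ _) => [[v2 T2] /= [-> accE fr2]].
have w0 : word v0 = word v by apply: eq_word.
have w1 : word v1 = word v by rewrite -w0; apply: eq_word.
have flagE : (v2 (vFlag K) != 0) = refuted k n K N inp T (word v).
  by rewrite fr2 ?flag1 /refuted ?w0 /v0 ?update_eq ?eval_invalid //; lia.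
have fr j : j < vX K -> v2 j = v j by move=> lt_j; rewrite fr2 ?fr1 ?fr0 //; lia.
rewrite /refute -flagE.
apply: wp_if; rewrite eval_v /=; try lia; move=> fl.
  apply: wp_set_tabK => /=; rewrite eval_v /=; last by lia.
  by rewrite fl accE w1.
by apply: wp_skip; rewrite fl.
Qed.

Lemma wp_report v T : wpK (Report K) (v, T) (fun s' =>
  s'.2 = (if T (enc N (word v)) != 0 then T else update T 0 1) /\
  forall j, j < vX K -> s'.1 j = v j).
Proof.
apply: wp_seq; apply: wp_mono (wp_encode_word _ _) => [[v1 T1] /= [-> accE fr]].
have fr' j : j < vX K -> v1 j = v j by move=> lt_j; apply: fr; lia.
apply: wp_if; rewrite eval_tab // eval_v /= ?accE; try lia; move=> T0.
  by apply: wp_skip; rewrite T0.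
by apply: wp_set_tabK; rewrite T0.
Qed.

Lemma wp_nest_word (F : seq nat -> memory -> memory) body :
  (forall v T, wpK body (v, T) (fun s' =>
     s'.2 = F (word v) T /\ forall j, j < vX K -> s'.1 j = v j)) ->
  forall v T, wpK (nest (iota 0 (K + K)) body) (v, T) (fun s' =>
    s'.2 = foldl (fun T l => F l T) T (words N (K + K)) /\
    forall j, K + K <= j < vX K -> s'.1 j = v j).
Proof.
move=> spec v T.
have := @wp_nest (nvars K) k n inp inp0 inp1 (fun j => vX K <= j) F body [::] (iota 0 (K + K)).
move=> /(_ _ (iota_uniq _ _) _ v T _) nestP.
apply: wp_mono (nestP _ _ _) => [[v1 T1] /= [-> fr]|v1 T1 _|j|//].
- rewrite size_iota; split=> // j lt_j; apply: fr; first by lia.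
  by rewrite mem_iota; lia.
- apply: wp_mono (spec v1 T1) => [[v2 T2] /= [-> fr]]; split=> // j.
  by rewrite -ltnNge; apply: fr.
- by rewrite mem_iota; lia.
Qed.

Lemma wp_sweeps v T : wpK (nest (iota (K + K) (K + K)) (nest (iota 0 (K + K)) (Refute K))) (v, T)
  (fun s' => s'.2 = foldl (fun T _ => sweep k n K N inp T) T (words N (K + K))).
Proof.
(* A whole sweep runs through the current word as well, so everything but the sweep counters counts
   as overwritten. *)
have := @wp_nest (nvars K) k n inp inp0 inp1 (fun j => ~~ (K + K <= j < vX K))
  (fun _ T => sweep k n K N inp T) (nest (iota 0 (K + K)) (Refute K)) [::] (iota (K + K) (K + K)).
move=> /(_ _ (iota_uniq _ _) _ v T _) nestP.
apply: wp_mono (nestP _ _ _) => [[v1 T1] /= [-> fr]|v1 T1 _|j|//].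
- by rewrite size_iota.
- apply: wp_mono (wp_nest_word wp_refute v1 T1) => [[v2 T2] /= [-> fr]]; split=> // j.
  by rewrite negbK; apply: fr.
- by rewrite mem_iota; lia.
Qed.

Lemma wp_reports v T : wpK (nest (iota 0 (K + K)) (Report K)) (v, T) (fun s' =>
  s'.2 = foldl (fun T l => if T (enc N l) != 0 then T else update T 0 1) T (words N (K + K))).
Proof.
apply: wp_mono (@wp_nest_word (fun l T => if T (enc N l) != 0 then T else update T 0 1)
  _ wp_report v T) => s'.
by case.
Qed.

(** Before the first unrefuted word the table is unchanged, and once cell 0 is nonzero it stays
    so. *)
Lemma foldl_report T s : T 0 = 0 ->
  (foldl (fun T l => if T (enc N l) != 0 then T else update T 0 1) T s 0 != 0) =
  has (fun l => T (enc N l) == 0) s.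
Proof.
move=> T0; set G := fun T l => _.
suff -> : forall T', (foldl G T' s 0 != 0) = (T' 0 != 0) || has (fun l => T' (enc N l) == 0) s.
  by rewrite T0.
elim: s => [|l s IHs] T' /=; first by rewrite orbF.
by rewrite IHs {1 2}/G; case: (T' (enc N l) == 0) => //=; rewrite orbT.
Qed.

End Programs.

(** * Assembling the polynomial-time algorithm *)

Lemma load_encode k (pi : 'S_k) n (tau : 'S_n) V :
  load (encode pi tau) = ram V k n (load (encode pi tau)) (fun=> 0, fun=> 0).
Proof.
apply: functional_extensionality => a; rewrite /ram; case: ltnP => // le_a.
rewrite /load nth_default; first by case: ifP.
by rewrite /= size_cat /one_line size_map size_map !size_enum_ord.
Qed.

Theorem theorem4 (C : perm_set) (hC : proper_subclass C C20) :
  pattern_PPM_in_P C.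
Proof.
case: hC => C_class C_sub C_neq.
have [m [sigma [sigma20 sigmaC]]] : exists m (sigma : 'S_m), C20 sigma /\ ~ C m sigma.
  have [//|none] := classic (exists m (sigma : 'S_m), C20 sigma /\ ~ C m sigma).
  case: C_neq => m sigma; split; first exact: C_sub.
  move=> s20; have [//|nC] := classic (C m sigma).
  by case: none; exists m, sigma.
have [K widthK] := bounded_pathwidth sigma20.
exists (Matching K), (time_poly (Matching K)) => k pi n tau Cpi le_kn.
have [B dec] : exists B, path_decomposition pi K B.
  by apply: widthK => [|cont]; [exact: C_sub | apply/sigmaC/(C_class _ pi)].
set inp := load (encode pi tau).
have sz : size (encode pi tau) = 2 + k + n.
  by rewrite /= size_cat /one_line size_map size_map !size_enum_ord.
have inp_pi (x : 'I_k) : inp (2 + x) = pi x.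
  rewrite /inp /load /= add0n nth_cat /one_line size_map size_enum_ord ltn_ord.
  by rewrite (nth_map x) ?size_enum_ord // nth_ord_enum.
have inp_tau (y : 'I_n) : inp (2 + k + y) = tau y.
  rewrite /inp /load /= add0n nth_cat /one_line size_map size_enum_ord.
  rewrite ifF; last by lia.
  by rewrite addKn (nth_map y) ?size_enum_ord // nth_ord_enum.
rewrite sz horner_time_poly /Matching.
(* An empty pattern has no position to carry a pebble, yet it is contained in every text. *)
have [k0|k_gt0] := posnP k.
  exists (expr_cost (Read (Const 0)) + 3).+1, (update inp 0 1); split.
  - apply: ExecIfF; first by rewrite /inp /load.
    exact: (ExecWrite (Const 0) (Const 1)).
  - by rewrite [time_bound _ _]/= ltnS leq_add2l leq_addl.
  - split=> // _; have no (x : 'I_k) : False by have := ltn_ord x; lia.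
    by exists (fun x => False_rect _ (no x)); split=> x; case: (no x).
have [le_kN le_nN] : k <= 2 + k + n /\ n <= 2 + k + n by lia.
have inp0 : inp 0 = k by []. have inp1 : inp 1 = n by [].
have [t1 [[v1 T1] [le1 ex1 /= T1E]]] := wp_sweeps K inp0 inp1 (fun=> 0) (fun=> 0).
have [t2 [[v2 T2] [le2 ex2 /= T2E]]] := wp_reports K inp0 inp1 v1 T1.
pose tw := (expr_cost (Const 0) + expr_cost (Tab (4 * K + 7) (Const 0))).+1.
exists (expr_cost (Read (Const 0)) + (t1 + (t2 + tw))).+1,
  (update (ram (4 * K + 7) k n inp (v2, T2)) 0 (T2 0)); split.
- apply: ExecIfT; first by rewrite /inp /load /= -lt0n.
  rewrite {1}(load_encode pi tau (4 * K + 7) : inp = _); apply: ExecSeq ex1 _; apply: ExecSeq ex2 _.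
  have <- : eval (ram (4 * K + 7) k n inp (v2, T2)) (Tab (4 * K + 7) (Const 0)) = T2 0.
    by rewrite eval_tab.
  exact: ExecWrite.
- by move: le1 le2; rewrite /tw /=; lia.
- rewrite update_eq T2E foldl_report ?T1E //.
    exact: (consistency_correct le_kN le_nN k_gt0 inp_pi inp_tau dec).
  by apply: consistency_table0; lia.
Qed.
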